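(* The Koszul resolution $\mathcal P_\infty$ of the dioperad $\mathcal P=\mathcal{L}ie^1_2\mathcal{B}i$ is the quasi-free dioperad on the $\mathbb S$-bimodule $E=\{E(m,n)\}_{m,n\ge1,\,m+n\ge3}$ with $$E(m,n)=\underbrace{(\mathrm{sgn}_m\oplus\dots\oplus\mathrm{sgn}_m)}_{m\text{ copies}}\otimes\mathbb 1_n[m-2]\quad(m+n\ge3),$$ and $0$ otherwise. Let $c^{m}_{n}(i)$, $0\le i\le m-1$, denote the basis element of $E(m,n)$ (with inputs $1,\dots,n$ and outputs $1,\dots,m$ in their natural order) corresponding to the basis element of $\mathcal P^!(m,n)$ with $i$ cooperations of the second kind. The differential of $\mathcal P_\infty$ is given by $$\partial\, c^m_n(i)=\sum(-1)^{\mathrm{sgn}(\sigma)+j(m-j)}\ G(i_1,i_2;\sigma,\tau,j,k),$$ where the sum is over $1\le k\le n$, $0\le j\le m-1$ with $2\le j+k\le m+n-2$, over $i_1+i_2=i$ (with $0\le i_1\le j$, $0\le i_2\le m-j-1$), over $(k,n-k)$-shuffles $\tau$ and over $(j,m-j)$-shuffles $\sigma$. Here $G(i_1,i_2;\sigma,\tau,j,k)$ is the two-vertex decorated graph whose upper vertex is decorated by $c^{j+1}_k(i_1)$, with inputs $\tau(1),\dots,\tau(k)$ and outputs $\sigma(1),\dots,\sigma(j),e$, and whose lower vertex is decorated by $c^{m-j}_{n-k+1}(i_2)$, with inputs $e,\tau(k+1),\dots,\tau(n)$ and outputs $\sigma(j+1),\dots,\sigma(m)$, where $e$ is the internal ed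ge.
   Context: Conventions: $\mathbb K$ is a field of characteristic zero; $V[i]_j=V_{i+j}$; differentials have degree $+1$; $\mathbb 1_n$ and $\mathrm{sgn}_n$ are the trivial and sign representations of $\mathbb S_n$; in signs, $\mathrm{sgn}(\sigma)$ denotes the parity of $\sigma$. An $\mathbb S$-bimodule $M$ is a family of $(\mathbb S_m,\mathbb S_n)$-bimodules $M(m,n)$ ($n$ inputs, $m$ outputs). $\mathcal F(M)$ is the free dioperad on $M$ (connected directed graphs of genus $0$ with vertices decorated by $M$; vertices carry Koszul signs when reordered, and a displayed two-vertex graph carries the ordered decoration upper $\otimes$ lower). Composites are read from inputs (top) to outputs (bottom). The dioperad $\mathcal P=\mathcal{L}ie^1_2\mathcal{B}i=\mathcal F(M)/(R)$: $M(1,2)=\mathbb 1_1\otimes(\mathbb 1_2[-1])$ with basis $\ell$ (degree $1$, symmetric in its inputs), $M(2,1)=(\mathrm{sgn}_2\oplus\mathrm{sgn}_2)\otimes\mathbb 1_1$ with basis $\delta_1,\delta_2$ (degree $0$, skew in their outputs), and $M(m,n)=0$ otherwise. Write $\ell\ell(a,b,c)$ for the composite ''apply $\ell$ to inputs $a,b$, then $\ell$ to the result and input $c$''; $\delta_x\delta_y(a,b,c)$ for the composite ''apply $\delta_x$ to the input; its second output is output $c$; apply $\delta_y$ to its first output, giving outputs $a,b$''; $\delta_x\ell$ for $\delta_x$ applied to $\ell$ of inputs $1,2$, with outputs $1,2$; and $C_x(i,j;k,l)$ for the composite ''apply $\delta_x$ to input $i$; its first output is output $k$; apply $\ell$ to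 (its second output, input $j$), giving output $l$''. The relations $R$ are: (a) $\ell\ell(1,2,3)+\ell\ell(2,3,1)+\ell\ell(3,1,2)$; (b) $\delta_x\delta_x(1,2,3)+\delta_x\delta_x(2,3,1)+\delta_x\delta_x(3,1,2)$ for $x=1,2$; (c) $\sum_{(a,b,c)}\big(\delta_1\delta_2(a,b,c)+\delta_2\delta_1(a,b,c)\big)$, the sum over $(a,b,c)\in\{(1,2,3),(2,3,1),(3,1,2)\}$; (d) $\delta_x\ell-C_x(1,2;1,2)-C_x(2,1;1,2)+C_x(1,2;2,1)+C_x(2,1;2,1)$ for $x=1,2$. The Koszul resolution is $\mathcal P_\infty=\Omega(\mathcal P^{¡})$, the cobar construction on the Koszul dual codioperad: the free dioperad on the suspension of the coaugmentation coideal of $\mathcal P^{¡}$, with differential determined by the two-vertex part of the cocomposition of $\mathcal P^{¡}$. It comes with a quasi-isomorphism $\mathcal P_\infty\to\mathcal P$. The codioperad $\mathcal P^{¡}$ is related to the Koszul dual dioperad $\mathcal P^!$ by $(\mathcal P^{¡})_{(s)}(m,n)\cong\Sigma^{-s}\big(\mathrm{sgn}_m\otimes(\mathcal P^!)_{(s)}(m,n)^*\otimes\mathrm{sgn}_n\big)$ ($\Sigma^{-1}$ desuspension, $(s)$ weight). The dioperad $\mathcal P^!$ is generated by a product $\ell^\vee$ and two cooperations $\delta_1^\vee,\delta_2^\vee$ dual to $\ell,\delta_1,\delta_2$. For $m,n\geq 1$, $m+n\geq 3$, a basis of $\mathcal P^!(m,n)$ is indexed by $0\le i\le m-1$: the iterated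 product $\ell^\vee(\cdots\ell^\vee(\ell^\vee(1,2),3)\cdots,n)$ followed by $m-1-i$ cooperations $\delta^\vee_1$ and then $i$ cooperations $\delta^\vee_2$, each successive cooperation applied to the first output of the previous one, outputs numbered $1,\dots,m$ from left to right. Quasi-free means free as a dioperad, with a differential not necessarily induced from one on the generators. *)

(* Defs.v *)
From HB Require Import structures.
From mathcomp Require Import all_boot all_order all_fingroup all_algebra.
From mathcomp Require Import boolp functions.

Set Implicit Arguments.
Unset Strict Implicit.
Unset Printing Implicit Defensive.
Import GRing.Theory.
Local Open Scope ring_scope.

(** * Graded modules

    A graded module is a module with the family of projections onto its
    homogeneous components.  Differentials have degree [+1]. *)

Record grmod (K : fieldType) := GrMod {
  gr_sort :> lmodType K;
  gr_proj : int -> {linear gr_sort -> gr_sort};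
  gr_projK : forall d e v,
    gr_proj d (gr_proj e v) = if d == e then gr_proj e v else 0;
  gr_sum : forall v, exists2 s : seq int, uniq s & v = \sum_(d <- s) gr_proj d v
}.

Definition hom (K : fieldType) (V : grmod K) (d : int) (v : V) : Prop :=
  gr_proj V d v = v.

Definition ksign (K : fieldType) (d : int) : K := (-1) ^+ `|d|%N.

(** * Relabellings of finite sets of legs *)

Definition smap (A A' B B' : Type) (f : A -> A') (g : B -> B') (u : A + B) :
    A' + B' :=
  match u with inl a => inl (f a) | inr b => inr (g b) end.

Definition oswap (A : Type) (u : option (option A)) : option (option A) :=
  match u with
  | None => Some None
  | Some None => None
  | Some (Some a) => Some (Some a)
  end.

Definition opull_r (A C : Type) (u : A + option C) : option (A + C) :=
  match u with inl a => Some (inl a) | inr c => omap inr c end.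

Definition opull_l (D F : Type) (u : option D + F) : option (D + F) :=
  match u with inl d => omap inl d | inr f => Some (inr f) end.

Definition sassoc (A C E : Type) (u : (A + C) + E) : A + (C + E) :=
  match u with
  | inl (inl a) => inl a
  | inl (inr c) => inr (inl c)
  | inr e => inr (inr e)
  end.

Definition sswap_r (A C E : Type) (u : (A + E) + C) : (A + C) + E :=
  match u with
  | inl (inl a) => inl (inl a)
  | inl (inr e) => inr e
  | inr c => inl (inr c)
  end.

Definition sswap_l (A C E : Type) (u : C + (A + E)) : A + (C + E) :=
  match u with
  | inl c => inr (inl c)
  | inr (inl a) => inl a
  | inr (inr e) => inr (inr e)
  end.

(** * Dioperads

    [P A B] is the module of operations whose outputs are labelled by the
    finite set [A] and whose inputs are labelled by the finite set [B]; the
    component P(m,n) is [P 'I_m 'I_n].  [dact f g] renames the outputs along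
    [f] and the inputs along [g]; it is meaningful only for bijective [f], [g].
    [dcomp x y] is the two-vertex graph with upper vertex [x], lower vertex [y]
    and decoration x (x) y: the output [None] of [x] is plugged into the input
    [None] of [y].  The three associativity axioms are the three shapes of
    trees with three vertices; in the last two, two vertices are exchanged,
    whence the Koszul sign. *)

Record dioperad (K : fieldType) := Dioperad {
  dop :> finType -> finType -> grmod K;
  dact : forall A A' B B' : finType,
    (A -> A') -> (B -> B') -> dop A B -> dop A' B';
  dcomp : forall A B C D : finType,
    dop (option A) B -> dop C (option D) -> dop (A + C)%type (B + D)%type;
  dunit : dop 'I_1 'I_1;

  dact_linear : forall (A A' B B' : finType) (f : A -> A') (g : B -> B'),
    bijective f -> bijective g -> linear (dact f g);
  dact_hom : forall (A A' B B' : finType) (f : A -> A') (g : B -> B') d x,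
    bijective f -> bijective g -> hom d x -> hom d (dact f g x);
  dact_id : forall (A B : finType) (x : dop A B), dact id id x = x;
  dact_comp : forall (A A' A'' B B' B'' : finType)
      (f : A -> A') (f' : A' -> A'') (g : B -> B') (g' : B' -> B'') x,
    bijective f -> bijective f' -> bijective g -> bijective g' ->
    dact (f' \o f) (g' \o g) x = dact f' g' (dact f g x);

  dcomp_linearl : forall (A B C D : finType) (y : dop C (option D)),
    linear (fun x : dop (option A) B => dcomp x y);
  dcomp_linearr : forall (A B C D : finType) (x : dop (option A) B),
    linear (fun y : dop C (option D) => dcomp x y);
  dcomp_hom : forall (A B C D : finType)
      (x : dop (option A) B) (y : dop C (option D)) d e,
    hom d x -> hom e y -> hom (d + e) (dcomp x y);
  dcomp_act : forall (A A' B B' C C' D D' : finType)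
      (f : A -> A') (g : B -> B') (h : C -> C') (k : D -> D')
      (x : dop (option A) B) (y : dop C (option D)),
    bijective f -> bijective g -> bijective h -> bijective k ->
    dcomp (dact (omap f) g x) (dact h (omap k) y)
    = dact (smap f h) (smap g k) (dcomp x y);

  dunit_hom : hom 0 dunit;
  dcomp_unitl : forall (C D : finType) (y : dop C (option D)),
    dcomp (dact (unlift (ord0 : 'I_1)) id dunit) y
    = dact inr (oapp inr (inl ord0)) y;
  dcomp_unitr : forall (A B : finType) (x : dop (option A) B),
    dcomp x (dact id (unlift (ord0 : 'I_1)) dunit)
    = dact (oapp inl (inr ord0)) inl x;

  dcomp_seq : forall (A B C D E F : finType) (x : dop (option A) B)
      (y : dop (option C) (option D)) (z : dop E (option F)),
    dact (@sassoc _ _ _) (@sassoc _ _ _)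
      (dcomp (dact (@opull_r _ _) id (dcomp x y)) z)
    = dcomp x (dact id (@opull_l _ _) (dcomp y z));
  dcomp_parout : forall (A B C D E F : finType) (x : dop (option (option A)) B)
      (y : dop C (option D)) (z : dop E (option F)) d e,
    hom d y -> hom e z ->
    dcomp (dact (@opull_l _ _) id (dcomp x y)) z
    = ksign K (d * e) *: dact (@sswap_r _ _ _) (@sswap_r _ _ _)
        (dcomp (dact (@opull_l _ _) id (dcomp (dact (@oswap _) id x) z)) y);
  dcomp_parin : forall (A B C D E F : finType) (x : dop (option A) B)
      (y : dop (option C) D) (z : dop E (option (option F))) d e,
    hom d x -> hom e y ->
    dcomp x (dact id (@opull_r _ _) (dcomp y z))
    = ksign K (d * e) *: dact (@sswap_l _ _ _) (@sswap_l _ _ _)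
        (dcomp y (dact id (@opull_r _ _) (dcomp x (dact id (@oswap _) z))))
}.

Record dgdioperad (K : fieldType) := DGDioperad {
  dg_dop :> dioperad K;
  diff : forall A B : finType, dg_dop A B -> dg_dop A B;
  diff_linear : forall A B : finType, linear (@diff A B);
  diff_hom : forall (A B : finType) d (x : dg_dop A B),
    hom d x -> hom (d + 1) (diff x);
  diff_act : forall (A A' B B' : finType) (f : A -> A') (g : B -> B') x,
    bijective f -> bijective g -> diff (dact f g x) = dact f g (diff x);
  diff_comp : forall (A B C D : finType) d
      (x : dg_dop (option A) B) (y : dg_dop C (option D)), hom d x ->
    diff (dcomp x y) = dcomp (diff x) y + ksign K d *: dcomp x (diff y);
  diff_diff : forall (A B : finType) (x : dg_dop A B), diff (diff x) = 0
}.

Record is_dmorphism (K : fieldType) (P Q : dioperad K)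
    (f : forall A B : finType, P A B -> Q A B) : Prop := {
  dmor_linear : forall A B : finType, linear (@f A B);
  dmor_hom : forall (A B : finType) d (x : P A B), hom d x -> hom d (f A B x);
  dmor_act : forall (A A' B B' : finType) (g : A -> A') (h : B -> B') x,
    bijective g -> bijective h -> f A' B' (dact g h x) = dact g h (f A B x);
  dmor_comp : forall (A B C D : finType)
      (x : P (option A) B) (y : P C (option D)),
    f _ _ (dcomp x y) = dcomp (f _ _ x) (f _ _ y);
  dmor_unit : f _ _ (dunit P) = dunit Q
}.

(** The output [o] of [x] is plugged into the input [i] of [y]; the remaining
    legs of each vertex keep their order. *)
Definition graft (K : fieldType) (P : dioperad K) (j k p q : nat)
    (o : 'I_j.+1) (i : 'I_q.+1) (x : P 'I_j.+1 'I_k) (y : P 'I_p 'I_q.+1) :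
    P ('I_j + 'I_p)%type ('I_k + 'I_q)%type :=
  dcomp (dact (unlift o) id x) (dact id (unlift i) y).

(** * Graded S-bimodules and free dioperads *)

Record sbimod (K : fieldType) := SBimod {
  sb :> nat -> nat -> int -> lmodType K;
  sact : forall m n d, 'S_m -> 'S_n -> sb m n d -> sb m n d;
  sact_linear : forall m n d (s : 'S_m) (t : 'S_n), linear (@sact m n d s t);
  sact1 : forall m n d (x : sb m n d), sact 1%g 1%g x = x;
  sactM : forall m n d (s s' : 'S_m) (t t' : 'S_n) (x : sb m n d),
    sact (s * s')%g (t * t')%g x = sact s' t' (sact s t x)
}.

Record is_bimod_to_dioperad (K : fieldType) (X : sbimod K) (P : dioperad K)
    (f : forall m n d, X m n d -> P 'I_m 'I_n) : Prop := {
  btd_linear : forall m n d, linear (@f m n d);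
  btd_hom : forall m n d (x : X m n d), hom d (f m n d x);
  btd_act : forall m n d (s : 'S_m) (t : 'S_n) (x : X m n d),
    f m n d (sact s t x) = dact s t (f m n d x)
}.

Record is_bimod_iso (K : fieldType) (X Y : sbimod K)
    (f : forall m n d, X m n d -> Y m n d) : Prop := {
  bi_linear : forall m n d, linear (@f m n d);
  bi_bij : forall m n d, bijective (@f m n d);
  bi_act : forall m n d (s : 'S_m) (t : 'S_n) (x : X m n d),
    f m n d (sact s t x) = sact s t (f m n d x)
}.

Definition is_free (K : fieldType) (X : sbimod K) (F : dioperad K)
    (iota : forall m n d, X m n d -> F 'I_m 'I_n) : Prop :=
  is_bimod_to_dioperad iota /\
  forall (P : dioperad K) (g : forall m n d, X m n d -> P 'I_m 'I_n),
    is_bimod_to_dioperad g ->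
    exists2 f : forall A B : finType, F A B -> P A B,
      is_dmorphism f /\ (forall m n d x, f _ _ (iota m n d x) = g m n d x) &
      forall f' : forall A B : finType, F A B -> P A B,
        is_dmorphism f' -> (forall m n d x, f' _ _ (iota m n d x) = g m n d x) ->
        forall (A B : finType) (x : F A B), f' A B x = f A B x.

(** * Quadratic dioperads on a symmetric product and two skew cooperations

    [l] is a product, [del ord0] and [del ord_max] are the two cooperations.
    The labels 1, 2, 3 are the ordinals 0, 1, 2. *)

Section TwoVertex.
Variables (K : fieldType) (P : dioperad K).
Variables (l : P 'I_1 'I_2) (del : 'I_2 -> P 'I_2 'I_1).

Definition cyc (w : 'I_3) (k : nat) : 'I_3 := inZp (w + k).

(** ll(a,b,c), with (a,b,c) the cyclic permutation of (1,2,3) starting at [w]. *)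
Definition mono_ll (w : 'I_3) : P 'I_1 'I_3 :=
  dact (fun _ => ord0)
       (fun u : 'I_2 + 'I_1 =>
          match u with inl a => cyc w a | inr _ => cyc w 2 end)
       (graft ord0 ord0 l l).

(** del_x del_y (a,b,c), with (a,b,c) as above. *)
Definition mono_dd (w : 'I_2 * 'I_2 * 'I_3) : P 'I_3 'I_1 :=
  dact (fun u : 'I_1 + 'I_2 =>
          match u with inl _ => cyc w.2 2 | inr b => cyc w.2 b end)
       (fun _ => ord0)
       (graft ord0 ord0 (del w.1.1) (del w.1.2)).

(** [(x, None)] is del_x l; [(x, Some (i, k))] is C_x(i,j;k,l), where j and l
    are the labels other than i and k. *)
Definition mono_ld (w : 'I_2 * option ('I_2 * 'I_2)) : P 'I_2 'I_2 :=
  match w.2 with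
  | None =>
      dact (fun u : 'I_0 + 'I_2 => match u with inl _ => ord0 | inr b => b end)
           (fun u : 'I_2 + 'I_0 => match u with inl a => a | inr _ => ord0 end)
           (graft ord0 ord0 l (del w.1))
  | Some (i, k) =>
      dact (fun u : 'I_1 + 'I_1 =>
              match u with inl _ => k | inr _ => rev_ord k end)
           (fun u : 'I_1 + 'I_1 =>
              match u with inl _ => i | inr _ => rev_ord i end)
           (graft ord_max ord0 (del w.1) l)
  end.

(** The iterated product l(...l(l(1,2),3)...,n+1). *)
Fixpoint iter_prod (n : nat) : P 'I_1 'I_n.+1 :=
  if n is n'.+1 then
    dact (fun _ => ord0)
         (fun u : 'I_n'.+1 + 'I_1 => inord
            match u with inl a => a : nat | inr b => (n'.+1 + b)%N end)
         (graft ord0 ord0 (iter_prod n') l)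
  else dunit P.

(** The iterated product with n+1 inputs followed by t cooperations, the first
    p of them of the first kind and the others of the second kind; each one is
    applied to the first output of the previous one. *)
Fixpoint comb (n p t : nat) : P 'I_t.+1 'I_n.+1 :=
  if t is t'.+1 then
    dact (fun u : 'I_t' + 'I_2 => inord
            match u with inl a => a.+2 | inr b => b : nat end)
         (fun u : 'I_n.+1 + 'I_0 => match u with inl b => b | inr _ => ord0 end)
         (graft ord0 ord0 (comb n p t')
            (del (if (t' < p)%N then ord0 else ord_max)))
  else iter_prod n.

End TwoVertex.

(** [quad_dl], [quad_dd]: degrees of the product and of the cooperations.
    [quad_13], [quad_31], [quad_22]: relations, as coordinate vectors in the
    monomial bases of the weight two part of the free dioperad. *)
Record quadratic (K : fieldType) := Quadratic {
  quad_dl : int;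
  quad_dd : int;
  quad_13 : {ffun 'I_3 -> K} -> Prop;
  quad_31 : {ffun 'I_2 * 'I_2 * 'I_3 -> K} -> Prop;
  quad_22 : {ffun 'I_2 * option ('I_2 * 'I_2) -> K} -> Prop
}.

Record is_model (K : fieldType) (q : quadratic K) (P : dioperad K)
    (l : P 'I_1 'I_2) (del : 'I_2 -> P 'I_2 'I_1) : Prop := {
  mod_dl : hom (quad_dl q) l;
  mod_dd : forall x, hom (quad_dd q) (del x);
  mod_syml : dact id (@rev_ord 2) l = l;
  mod_skewd : forall x, dact (@rev_ord 2) id (del x) = - del x;
  mod_13 : forall u, quad_13 q u -> \sum_w u w *: mono_ll l w = 0;
  mod_31 : forall u, quad_31 q u -> \sum_w u w *: mono_dd del w = 0;
  mod_22 : forall u, quad_22 q u -> \sum_w u w *: mono_ld l del w = 0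
}.

(** [P] is the quotient of the free dioperad on [l], [del] by the ideal
    generated by the relations. *)
Definition is_presented (K : fieldType) (q : quadratic K) (P : dioperad K)
    (l : P 'I_1 'I_2) (del : 'I_2 -> P 'I_2 'I_1) : Prop :=
  is_model q l del /\
  forall (D : dioperad K) (l' : D 'I_1 'I_2) (del' : 'I_2 -> D 'I_2 'I_1),
    is_model q l' del' ->
    exists2 f : forall A B : finType, P A B -> D A B,
      is_dmorphism f /\ (f _ _ l = l' /\ forall x, f _ _ (del x) = del' x) &
      forall f' : forall A B : finType, P A B -> D A B,
        is_dmorphism f' -> f' _ _ l = l' -> (forall x, f' _ _ (del x) = del' x) ->
        forall (A B : finType) (x : P A B), f' A B x = f A B x.

Definition LieBi (K : fieldType) : quadratic K := {|
  quad_dl := 1;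
  quad_dd := 0;
  quad_13 := fun u => u = [ffun=> 1];
  quad_31 := fun u =>
    (exists x, u = [ffun w => ((w.1.1 == x) && (w.1.2 == x))%:R]) \/
    u = [ffun w => (w.1.1 != w.1.2)%:R];
  quad_22 := fun u => exists x, u = [ffun w =>
    if w.1 != x then 0 else
    match w.2 with
    | None => 1
    | Some (_, k) => if k == ord0 then -1 else 1
    end]
|}.

(** * Koszul dual codioperad

    Write s^-1 for the desuspension and C for the Koszul dual codioperad of the
    quadratic data (M, R): the subcodioperad of the cofree codioperad on s^-1 M
    with corelations s^-2 R.  An element of the cofree codioperad is identified
    with the function giving its coefficients on the monomials, that is, with a
    linear form on the free dioperad on (s^-1 M)^*; it lies in C when this form
    vanishes on the ideal generated by the annihilator of s^-2 R.  So C is the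
    graded linear dual of the dioperad Q presented by [koszul_dual q], with
    generators (s^-1 M)^* and relations the annihilator of s^-2 R.  Reading off
    coefficients of graphs introduces no Koszul sign: the form f' (x) f'' takes
    the value f'(x) f''(y) on the two-vertex graph with upper vertex x and lower
    vertex y.

    The Koszul dual dioperad P^! differs from Q only by the shift and the sign
    representations in
      C_(w)(m,n) = s^-w (sgn_m (x) P^!_(w)(m,n)^* (x) sgn_n),
    w being the weight; a monomial of P^! in the dual generators corresponds to
    the same monomial of Q.

    The desuspension of (upper (x) lower) is
    (-1)^|upper| (s^-1 upper) (x) (s^-1 lower), whence the signs below. *)
Definition koszul_dual (K : fieldType) (q : quadratic K) : quadratic K := {|
  quad_dl := 1 - quad_dl q;
  quad_dd := 1 - quad_dd q;
  quad_13 := fun u => forall r, quad_13 q r ->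
    \sum_w (ksign K (quad_dl q) * r w) * u w = 0;
  quad_31 := fun u => forall r, quad_31 q r ->
    \sum_w (ksign K (quad_dd q) * r w) * u w = 0;
  quad_22 := fun u => forall r, quad_22 q r ->
    \sum_w (ksign K (if w.2 is None then quad_dl q else quad_dd q) * r w) * u w
    = 0
|}.

(** The component of degree d of the suspension s C(m,n) of the coaugmentation
    coideal of the codioperad C dual to [Q], i.e. the linear forms on Q(m,n)
    that are concentrated in degree 1 - d.  [Q] is generated by operations with
    m + n >= 3, so that Q(1,1) is spanned by the unit and the coaugmentation
    coideal is the part of C with m + n >= 3. *)
Definition coideal_pred (K : fieldType) (Q : dioperad K) (m n : nat) (d : int) :
    {pred Q 'I_m 'I_n -> K^o} :=
  [pred f | `[< [/\ linear f,
    forall e x, hom e x -> e != 1 - d -> f x = 0 &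
    (m + n < 3)%N -> forall x, f x = 0] >]].

Section Coideal.
Variables (K : fieldType) (Q : dioperad K) (m n : nat) (d : int).

Lemma coideal_submod_closed : submod_closed (@coideal_pred K Q m n d).
Proof.
split=> [|a f g].
  apply/asboolP; split=> // b x y /=.
  by rewrite /GRing.zero /= /GRing.zero /= scaler0 addr0.
move=> /asboolP[lf hf zf] /asboolP[lg hg zg]; apply/asboolP.
have E x : (a *: f + g) x = a * f x + g x by [].
split.
- move=> b x y; rewrite !E lf lg mulrDr scalerDr addrACA.
  by congr (_ + _ + _); rewrite /GRing.scale /= mulrCA.
- by move=> e x hx ne; rewrite E (hf e) ?(hg e) // mulr0 addr0.
- by move=> mn x; rewrite E zf ?zg // mulr0 addr0.
Qed.

HB.instance Definition _ :=
  GRing.isSubmodClosed.Build K (Q 'I_m 'I_n -> K^o) (@coideal_pred K Q m n d)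
    coideal_submod_closed.

Record coideal := Coideal {
  coideal_fun :> Q 'I_m 'I_n -> K^o;
  _ : coideal_fun \in @coideal_pred K Q m n d
}.

HB.instance Definition _ := [isSub for coideal_fun].
HB.instance Definition _ := [Choice of coideal by <:].
HB.instance Definition _ := [SubChoice_isSubLmodule of coideal by <:].

End Coideal.

Section CoidealBimod.
Variables (K : fieldType) (Q : dioperad K).

Lemma perm_bij n (s : 'S_n) : bijective s.
Proof. by exists (s^-1)%g => x; rewrite ?permK ?permKV. Qed.

Lemma coideal_actP m n d (s : 'S_m) (t : 'S_n) (f : coideal Q m n d) :
  (fun x => f (dact (s^-1)%g (t^-1)%g x)) \in @coideal_pred K Q m n d.
Proof.
case: f => f /= /asboolP[lf hf zf]; apply/asboolP; split.
- by move=> a x y; rewrite dact_linear ?lf //; apply: perm_bij.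
- by move=> e x hx ne; rewrite (hf e) //; apply: dact_hom => //; apply: perm_bij.
- by move=> mn x; rewrite zf.
Qed.

Definition coideal_act m n d (s : 'S_m) (t : 'S_n) (f : coideal Q m n d) :
  coideal Q m n d := Coideal (coideal_actP s t f).

Lemma coideal_ext m n d (f g : coideal Q m n d) : f =1 g -> f = g.
Proof. by move=> fg; apply: val_inj; apply: funext. Qed.

Lemma coideal_act_linear m n d (s : 'S_m) (t : 'S_n) :
  linear (@coideal_act m n d s t).
Proof. by move=> a f g; apply: coideal_ext. Qed.

Lemma coideal_act1 m n d (f : coideal Q m n d) : coideal_act 1%g 1%g f = f.
Proof.
apply: coideal_ext => x /=; rewrite !invg1; congr (coideal_fun f _).
rewrite -[RHS]dact_id; congr (dact _ _ x); apply: funext => i; exact: perm1.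
Qed.

Lemma coideal_actM m n d (s s' : 'S_m) (t t' : 'S_n) (f : coideal Q m n d) :
  coideal_act (s * s')%g (t * t')%g f = coideal_act s' t' (coideal_act s t f).
Proof.
apply: coideal_ext => x /=; rewrite -dact_comp; do ?exact: perm_bij.
by congr (f (dact _ _ x)); apply: funext => i; rewrite invMg permM.
Qed.

Definition coideal_bimod : sbimod K := {|
  sb := fun m n d => coideal Q m n d : lmodType K;
  sact := coideal_act;
  sact_linear := coideal_act_linear;
  sact1 := coideal_act1;
  sactM := coideal_actM
|}.

End CoidealBimod.

(** * Two-vertex graphs and the cobar construction *)

(** [s] is a (j, m-j)-shuffle. *)
Definition is_shuffle (m : nat) (j : nat) (s : 'S_m) : bool :=
  [forall a : 'I_m, forall b : 'I_m,
    (a < b)%N && ((b < j) || (j <= a))%N ==> (s a < s b)%N].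

(** s(1), ..., s(j) on the first summand, s(j+1), ..., s(m) on the second. *)
Definition spread (m j : nat) (jm : (j <= m)%N) (s : 'S_m)
    (u : 'I_j + 'I_(m - j)) : 'I_m :=
  s (cast_ord (subnKC jm) (unsplit u)).

(** The two-vertex graph with upper vertex [x], with inputs t(1), ..., t(k) and
    outputs s(1), ..., s(j), e, and lower vertex [y], with inputs
    e, t(k+1), ..., t(n) and outputs s(j+1), ..., s(m). *)
Definition two_vertex (K : fieldType) (P : dioperad K) (m n : nat)
    (j : 'I_m) (k : 'I_n.+1) (s : 'S_m) (t : 'S_n)
    (x : P 'I_j.+1 'I_k) (y : P 'I_(m - j) 'I_(n - k).+1) : P 'I_m 'I_n :=
  dact (spread (ltnW (ltn_ord j)) s) (spread (leq_ord k) t)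
    (graft ord_max ord0 x y).

(** Every two-vertex graph both of whose vertices have at least one input, one
    output and three legs is of the above form for a unique [(j, k, s, t)]
    satisfying this condition. *)
Definition is_shape (m n : nat) (j : 'I_m) (k : 'I_n.+1) (s : 'S_m) (t : 'S_n) :
    bool :=
  [&& 0 < k, 2 <= j + k <= m + n - 2, is_shuffle j s & is_shuffle k t]%N.

(** A sum of decompositions f' (x) f'' of each two-vertex type, whose factors
    are homogeneous; degrees are those in the suspension. *)
Definition cotensors (K : fieldType) (Q : dioperad K) (m n : nat) :=
  forall (j : 'I_m) (k : 'I_n.+1), 'S_m -> 'S_n ->
    seq ({d : int & coideal Q j.+1 k d} *
         {d : int & coideal Q (m - j) (n - k).+1 d}).

(** [D] represents the two-vertex part of the reduced cocomposition of [f],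
    which is dual to the composition of two operations of [Q].  The difference
    of two representatives is zero in the tensor products. *)
Definition is_cocomposition (K : fieldType) (Q : dioperad K) (m n : nat) (d : int)
    (f : coideal Q m n d) (D : cotensors Q m n) : Prop :=
  forall j k s t, is_shape j k s t ->
  forall (x : Q 'I_j.+1 'I_k) (y : Q 'I_(m - j) 'I_(n - k).+1),
    f (two_vertex s t x y)
    = \sum_(r <- D j k s t) tagged r.1 x * tagged r.2 y :> K.

(** [Om] is the cobar construction on the codioperad dual to [Q]: free on the
    suspension of its coaugmentation coideal, with
    d(s f) = sum (-1)^|f'| (s f') (x) (s f''). *)
Definition is_cobar (K : fieldType) (Q : dioperad K) (Om : dgdioperad K)
    (iota : forall m n d, coideal_bimod Q m n d -> Om 'I_m 'I_n) : Prop :=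
  is_free iota /\
  forall m n d (f : coideal Q m n d) (D : cotensors Q m n),
    is_cocomposition f D ->
    diff (iota m n d f) =
      \sum_(j < m) \sum_(k < n.+1) \sum_(s : 'S_m) \sum_(t : 'S_n | is_shape j k s t)
      \sum_(r <- D j k s t) ksign K (tag r.1 - 1) *:
        two_vertex s t (iota _ _ _ (tagged r.1)) (iota _ _ _ (tagged r.2)).

(** * The S-bimodule E *)

Section E.
Variable K : fieldType.

Definition Erank (m n : nat) (d : int) : nat :=
  if [&& (0 < m)%N, (0 < n)%N, (3 <= m + n)%N & d == 2 - m%:Z] then m else 0.

Definition Eact m n d (s : 'S_m) (t : 'S_n) (v : 'rV[K]_(Erank m n d)) :
  'rV[K]_(Erank m n d) := (-1) ^+ odd_perm s *: v.

Lemma Eact_linear m n d (s : 'S_m) (t : 'S_n) : linear (@Eact m n d s t).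
Proof. by move=> a u v; rewrite /Eact scalerDr !scalerA mulrC. Qed.

Lemma Eact1 m n d (v : 'rV[K]_(Erank m n d)) :
  Eact (1%g : 'S_m) (1%g : 'S_n) v = v.
Proof. by rewrite /Eact odd_perm1 scale1r. Qed.

Lemma EactM m n d (s s' : 'S_m) (t t' : 'S_n) (v : 'rV[K]_(Erank m n d)) :
  Eact (s * s')%g (t * t')%g v = Eact s' t' (Eact s t v).
Proof. by rewrite /Eact scalerA odd_permM signr_addb mulrC. Qed.

Definition Ebimod : sbimod K := {|
  sb := fun m n d => 'rV[K]_(Erank m n d) : lmodType K;
  sact := Eact;
  sact_linear := Eact_linear;
  sact1 := Eact1;
  sactM := EactM
|}.

(** The basis vector c^m_n(i), in degree 2 - m. *)
Definition Ebasis (m n i : nat) : Ebimod m n (2 - m%:Z) :=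
  \row_j (j == i :> nat)%:R.

End E.

(* Main.v *)
Require Import Defs.
From HB Require Import structures.
From mathcomp Require Import all_boot all_order all_fingroup all_algebra.
From mathcomp Require Import boolp zify.

Set Implicit Arguments.
Unset Strict Implicit.
Unset Printing Implicit Defensive.
Import GRing.Theory.
Local Open Scope ring_scope.

(** The work lies in computing the dioperad [Q], whose dual is the Koszul dual
    codioperad; the differential is then read off from the composition of [Q].

    Lower bound: the polynomials [{poly K}], with one copy for every pair of
    finite sets (A, B) placed in degree |A| - 1, bijections of outputs acting by
    their sign and composition being the product up to sign, form a dioperad that
    satisfies the relations of [Q]: send the product and the first cooperation
    to 1 and the second cooperation to 'X. The comb with i cooperations of the
    second kind goes to 'X^i, so the combs are linearly independent.

    Upper bound: up to sign and relabelling, the relations allow every composite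
    of combs to be rewritten as a comb, and the combs are (skew-)symmetric. Hence
    the span of the relabelled combs is a subdioperad containing the generators,
    that is, all of [Q]. Signs need not be tracked here, since they can be
    recovered afterwards in the polynomial model. *)

(** [Q] is known only through its universal property, so an argument about all of [Q] cannot inspect
    its elements: [Q] is mapped to the subdioperad of the elements in question, and uniqueness
    identifies the composite with the inclusion as the identity. Composition distinguishes the
    plugged legs, so it does not respect equality up to relabelling in general; it does for
    operations that absorb permutations of their legs up to sign. Symmetry of the combs is therefore
    proved along with the rewriting. Signs return at the end: plus or minus a comb is sent to plus
    or minus ['X^i], so the polynomial carries the missing sign.

    The cocomposition is then dual to multiplication of polynomials, whence i_1 + i_2 = i. A
    two-vertex graph has sign exponent sgn(s) + j + j(m-j): the term j comes from bringing the
    internal edge, last among the outputs of the upper vertex, to the front, and j(m-j) is the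
    coboundary factor. The cobar sign (-1)^|f'| is (-1)^j and removes the middle term. *)

Local Notation hom := Defs.hom.

(** * Signs of bijections *)

(** Signs are needed for bijections between different finite sets, such as [A + option C] and
    [option (A + C)]; the enumeration supplies each finite set with an order. *)
Definition prec (T : finType) (x y : T) : bool :=
  (index x (enum T) < index y (enum T))%N.

Lemma prec_irr (T : finType) (x : T) : prec x x = false.
Proof. exact: ltnn. Qed.

Lemma prec_neg (T : finType) (x y : T) : x != y -> prec y x = ~~ prec x y.
Proof.
move=> xy; rewrite /prec -leqNgt ltn_neqAle; case: eqP => //= e.
by case/eqP: xy; rewrite -(nth_index x (mem_enum T x)) -e nth_index ?mem_enum.
Qed.

Lemma prec_ord n (i j : 'I_n) : prec i j = (i < j)%N.
Proof. by rewrite /prec !index_enum_ord. Qed.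

Lemma enum_sum (A C : finType) :
  enum {: A + C} = map inl (enum A) ++ map inr (enum C).
Proof. by rewrite !enumT [in LHS]unlock. Qed.

Lemma enum_option (A : finType) : enum {: option A} = None :: map some (enum A).
Proof. by rewrite !enumT [in LHS]unlock. Qed.

Lemma prec_inl (A C : finType) (a a' : A) :
  prec (inl a : A + C) (inl a') = prec a a'.
Proof.
have M x : (inl x \in [seq (inl i : A + C) | i <- enum A]).
  by rewrite map_f ?mem_enum.
rewrite /prec enum_sum !index_cat !M !index_map //; by move=> ? ? [].
Qed.

Lemma prec_inr (A C : finType) (c c' : C) :
  prec (inr c : A + C) (inr c') = prec c c'.
Proof.
have N x : (inr x \in [seq (inl i : A + C) | i <- enum A]) = false.
  by apply/mapP => -[].
rewrite /prec enum_sum !index_cat !N ltn_add2l !index_map //; by move=> ? ? [].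
Qed.

Lemma prec_inlr (A C : finType) (a : A) (c : C) :
  prec (inl a : A + C) (inr c) = true.
Proof.
have N x : (inr x \in [seq (inl i : A + C) | i <- enum A]) = false.
  by apply/mapP => -[].
have M : (inl a \in [seq (inl i : A + C) | i <- enum A]).
  by rewrite map_f ?mem_enum.
by rewrite /prec enum_sum !index_cat N M ltn_addr ?index_mem.
Qed.

Lemma prec_inrl (A C : finType) (a : A) (c : C) :
  prec (inr c : A + C) (inl a) = false.
Proof. by rewrite prec_neg // prec_inlr. Qed.

Lemma prec_Some (A : finType) (a a' : A) : prec (Some a) (Some a') = prec a a'.
Proof.
by rewrite /prec enum_option /= ltnS !index_map //; move=> ? ? [].
Qed.

Lemma prec_None (A : finType) (a : A) : prec None (Some a) = true.
Proof. by rewrite /prec enum_option. Qed.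

Lemma prec_SomeN (A : finType) (a : A) : prec (Some a) None = false.
Proof. by rewrite /prec enum_option. Qed.

Definition precE := (prec_irr, prec_inl, prec_inr, prec_inlr, prec_inrl,
  prec_Some, prec_None, prec_SomeN, prec_ord).

Section Sgn.
Variable K : fieldType.

Definition inv_sign (b : bool) : K := if b then -1 else 1.

(** The double product over independent indices splits along sums and options, which is how the
    structure maps are evaluated. *)
Definition sgn (A A' : finType) (f : A -> A') : K :=
  \prod_a \prod_a' inv_sign (prec a a' && prec (f a') (f a)).

Lemma inv_sign_addb b b' : inv_sign (b (+) b') = inv_sign b * inv_sign b'.
Proof. by case: b b' => [] [] /=; rewrite /inv_sign ?mulrNN ?mul1r ?mulr1. Qed.

(* The factor of a pair in [sgn f] does not depend on the order of the pair. *)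
Lemma sgnE (A A' : finType) (f : A -> A') : injective f ->
  sgn f = \prod_(p : A * A | prec p.1 p.2)
    inv_sign (prec p.1 p.2 (+) prec (f p.1) (f p.2)).
Proof.
move=> fI; rewrite /sgn pair_big big_mkcond [RHS]big_mkcond /=.
apply: eq_bigr => -[a a'] _ /=; case: ifP => //= aa'.
rewrite aa' prec_neg //.
by apply: contraTneq aa' => /fI ->; rewrite prec_irr.
Qed.

(** Either condition selects one ordering of each pair of distinct elements, and [F] ignores the
    ordering. The pairs on which the two conditions disagree are swapped. *)
Lemma prod_unordered (A A' : finType) (f : A -> A') (F : A -> A -> K) :
  bijective f -> (forall a a', F a a' = F a' a) ->
  \prod_(p : A * A | prec (f p.1) (f p.2)) F p.1 p.2
  = \prod_(p : A * A | prec p.1 p.2) F p.1 p.2.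
Proof.
move=> /bij_inj fI Fs.
rewrite (bigID (fun p => prec p.1 p.2)) [RHS](bigID (fun p => prec (f p.1) (f p.2))) /=.
congr (_ * _); first by apply: eq_bigl => p; rewrite andbC.
rewrite (reindex_inj (h := fun p : A * A => (p.2, p.1))) /=; last first.
  by move=> [? ?] [? ?] [-> ->].
apply: eq_big => [[a a'] /=|[a a'] _ /=]; last exact: Fs.
have [->|ne] := eqVneq a a'; first by rewrite !prec_irr.
by rewrite (prec_neg ne) (@prec_neg _ (f a)) ?negbK 1?andbC ?(inj_eq fI).
Qed.

(** In the form of [sgnE], inversions add modulo 2: [g \o f] inverts a pair when exactly one of [f]
    at the pair and [g] at its image does. Pulling the product for [g] back along [f] changes the
    chosen orderings, which [prod_unordered] allows. *)
Lemma sgn_comp (A A' A'' : finType) (f : A -> A') (g : A' -> A'') :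
  bijective f -> bijective g -> sgn (g \o f) = sgn g * sgn f.
Proof.
move=> fB gB; have fI := bij_inj fB; have gI := bij_inj gB.
rewrite !sgnE //; last exact: inj_comp.
pose G a a' := inv_sign (if a == a' then false else
  prec (f a) (f a') (+) prec (g (f a)) (g (f a'))).
have -> : \prod_(p : A' * A' | prec p.1 p.2) inv_sign (prec p.1 p.2 (+) prec (g p.1) (g p.2))
    = \prod_(p : A * A | prec p.1 p.2) G p.1 p.2.
  rewrite -(prod_unordered fB); last first.
    move=> a a'; rewrite /G eq_sym; case: eqP => // /eqP ne.
    rewrite (@prec_neg _ (f a)) 1?(@prec_neg _ (g (f a))) ?(inj_eq gI) ?(inj_eq fI) 1?eq_sym //.
    by rewrite addNb addbN negbK.
  case: fB => h fK hK.
  rewrite (reindex (fun p : A * A => (f p.1, f p.2))) /=; last first.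
    by exists (fun p => (h p.1, h p.2)) => -[? ?] _ /=; rewrite ?fK ?hK.
  apply: eq_bigr => -[a a'] /= p; rewrite /G ifN //.
  by apply: contraTneq p => ->; rewrite prec_irr.
rewrite -big_split /=; apply: eq_bigr => -[a a'] /= p.
rewrite /G ifN; last by apply: contraTneq p => ->; rewrite prec_irr.
by rewrite -inv_sign_addb; congr inv_sign; rewrite p; do 2?case: prec.
Qed.

Lemma sgn_homo (A A' : finType) (f : A -> A') :
  {mono f : a a' / prec a a'} -> sgn f = 1.
Proof.
move=> fm; apply: big1 => a _; apply: big1 => a' _; rewrite fm.
have [->|ne] := eqVneq a a'; first by rewrite prec_irr.
by rewrite (prec_neg ne) andbN.
Qed.

Lemma sgn_id (A : finType) : sgn (@id A) = 1.
Proof. exact: sgn_homo. Qed.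

Lemma eq_sgn (A A' : finType) (f g : A -> A') : f =1 g -> sgn f = sgn g.
Proof. by move=> fg; apply: eq_bigr => a _; apply: eq_bigr => a' _; rewrite !fg. Qed.

Lemma prod_option (A : finType) (F : option A -> K) :
  \prod_x F x = F None * \prod_a F (Some a).
Proof.
by rewrite -[LHS]big_enum enum_option big_cons big_map big_enum.
Qed.

Lemma sgn_omap (A A' : finType) (f : A -> A') : sgn (omap f) = sgn f.
Proof.
rewrite /sgn !prod_option /= precE mul1r big1 ?mul1r; last first.
  by move=> a _; rewrite !precE.
apply: eq_bigr => a _; rewrite prod_option !precE mul1r.
by apply: eq_bigr => a' _; rewrite !precE.
Qed.

Lemma sgn_smap (A A' C C' : finType) (f : A -> A') (h : C -> C') :
  sgn (smap f h) = sgn f * sgn h.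
Proof.
rewrite /sgn big_sumType /=; congr (_ * _); apply: eq_bigr => a _.
  rewrite big_sumType /= [X in _ * X]big1 ?mulr1; last by move=> c _; rewrite !precE.
  by apply: eq_bigr => a' _; rewrite !precE.
rewrite big_sumType /= big1 ?mul1r; last by move=> c _; rewrite !precE.
by apply: eq_bigr => a' _; rewrite !precE.
Qed.

Lemma sgn_inv (A A' : finType) (f : A -> A') (g : A' -> A) :
  cancel f g -> cancel g f -> sgn g * sgn f = 1.
Proof.
move=> fK gK; rewrite -sgn_comp; [|by exists g|by exists f].
by rewrite -(sgn_id A); apply: eq_sgn => x /=.
Qed.

(** Reduces all transpositions to the one of [sgn_tperm01]. *)
Lemma sgn_conj n (s t : 'S_n) : sgn (s ^ t)%g = sgn s.
Proof.
have -> : sgn (s ^ t)%g = sgn (t \o (s \o t^-1%g)).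
  by apply: eq_sgn => x; rewrite /= /conjg !permM.
have B := @perm_bij n.
rewrite (sgn_comp (bij_comp (B s) (B _)) (B t)) (sgn_comp (B _) (B s)).
rewrite mulrCA [sgn t * _]mulrC [X in _ * X](_ : _ = 1) ?mulr1 //.
exact: (sgn_inv (permK t) (permKV t)).
Qed.

Lemma sgn_tperm01 n : sgn (tperm (ord0 : 'I_n.+2) (lift ord0 ord0)) = -1.
Proof.
pose i1 : 'I_n.+2 := lift ord0 ord0; rewrite -/i1.
(* If a' exceeds both a and 1, it is fixed and stays above the image of a; hence (0, 1) is the only
   inversion. *)
have t0 (a : 'I_n.+2) : (tperm ord0 i1 a <= maxn a 1)%N.
  by case: tpermP => [->|->|_ _] //; rewrite leq_maxl.
rewrite /sgn (bigD1 ord0) //= (bigD1 i1) //= !precE tpermL tpermR /=.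
rewrite [X in _ * X * _]big1; last first.
  move=> a' ne; rewrite !precE; case: tpermP => [->|e|n0 n1] //=.
    by rewrite e eqxx in ne.
  suff -> : (a' < i1)%N = false by rewrite andbF.
  by apply/negbTE; rewrite -leqNgt lt0n; apply/eqP => e; case: n0; apply: val_inj.
rewrite [X in _ * X]big1 ?mulr1 // => a a0; apply: big1 => a' _; rewrite !precE.
case: ltnP => //= aa'.
have a2 : (1 < a')%N.
  by apply: leq_ltn_trans aa'; rewrite lt0n; apply: contraNneq a0 => e; apply/eqP/val_inj.
rewrite (tpermD (z := a')); try by apply: contraTneq a2 => <-.
rewrite ltnNge (leq_trans (t0 a)) //.
by rewrite geq_max (ltnW aa') (ltnW a2).
Qed.

Lemma sgn_perm n (s : 'S_n) : sgn s = (-1) ^+ odd_perm s.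
Proof.
have T (x y : 'I_n) : x != y -> sgn (tperm x y) = -1.
  case: n x y {s} => [|[|n]] x y; [by case: x|by rewrite !ord1|].
  move=> ne; pose i1 : 'I_n.+2 := lift ord0 ord0; rewrite -(sgn_tperm01 n) -/i1.
  pose u := tperm ord0 x; pose v := tperm (u i1) y.
  (* [u * v] sends 0 to [x] and 1 to [y], so it conjugates the transposition of 0 and 1 into that of
     [x] and [y]. *)
  rewrite -(@sgn_conj _ (tperm ord0 i1) (u * v)%g) tpermJ !permM /u tpermL.
  have -> : v (tperm ord0 x i1) = y by rewrite /v tpermL.
  suff -> : v x = x by [].
  rewrite /v tpermD //; last by rewrite eq_sym.
  have : u i1 != u ord0 by rewrite (inj_eq perm_inj).
  by rewrite /u tpermL.
have [ts -> ts_ne] := prod_tpermP s.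
elim: ts ts_ne => [|t ts IH] /=.
  by rewrite big_nil odd_perm1 expr0 -(sgn_id 'I_n) => _; apply: eq_sgn => x; rewrite perm1.
case/andP=> tne /IH {}IH; rewrite big_cons odd_mul_tperm tne.
set q := (\prod_(_ <- _) _)%g in IH *.
have -> : sgn (tperm t.1 t.2 * q)%g = sgn (q \o tperm t.1 t.2).
  by apply: eq_sgn => x; rewrite permM.
rewrite sgn_comp; try exact: perm_bij.
by rewrite IH T // mulrC signr_addb.
Qed.

Lemma prod_const2 (A C : finType) (c : K) :
  \prod_(a : A) \prod_(b : C) c = c ^+ (#|A| * #|C|).
Proof.
under eq_bigr do rewrite prodr_const.
by rewrite prodr_const -exprM mulnC.
Qed.

(** The inversions are the pairs formed by [None], which moves to the front, and the elements of [A]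
    that it passes. *)
Lemma sgn_opull_r (A C : finType) : sgn (@opull_r A C) = (-1) ^+ #|A|.
Proof.
rewrite /sgn big_sumType /= [X in _ * X]big1 ?mulr1; last first.
  move=> c _; rewrite big_sumType /= big1 ?mul1r => [|a _]; last by rewrite !precE.
  rewrite prod_option big1 => [|c' _].
    by case: c => [c|]; rewrite /= !precE ?mul1r.
  case: c => [c|]; rewrite /= !precE //.
  have [->|ne] := eqVneq c c'; first by rewrite !precE.
  by rewrite (prec_neg ne) andbN.
rewrite -prodr_const; apply: eq_bigr => a _; rewrite big_sumType big1 ?mul1r; last first.
  move=> a' _; rewrite /= !precE.
  have [->|ne] := eqVneq a a'; first by rewrite !precE.
  by rewrite (prec_neg ne) andbN.
rewrite prod_option /= !precE big1 ?mul1r ?mulr1 // => c _; by rewrite !precE.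
Qed.

Lemma sgn_opull_l (A C : finType) : sgn (@opull_l A C) = 1.
Proof. by apply: sgn_homo => -[[a|]|c] [[a'|]|c'] /=; rewrite !precE. Qed.

Lemma sgn_sassoc (A C E : finType) : sgn (@sassoc A C E) = 1.
Proof. by apply: sgn_homo => -[[a|c]|e] [[a'|c']|e'] /=; rewrite !precE. Qed.

Lemma sgn_oswap (A : finType) : sgn (@oswap A) = -1.
Proof.
rewrite /sgn !prod_option /= !precE /= !mul1r ![\prod_(a : A) _]big1 ?mulr1 //;
  move=> a _; rewrite /= ?precE //.
rewrite !prod_option /= !precE !mul1r; apply: big1 => a' _; rewrite !precE.
have [->|ne] := eqVneq a a'; first by rewrite !precE.
by rewrite (prec_neg ne) andbN.
Qed.

Lemma prec_anti (A : finType) (a a' : A) :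
  inv_sign (prec a a' && prec a' a) = 1.
Proof.
have [->|ne] := eqVneq a a'; first by rewrite precE.
by rewrite (prec_neg ne) andbN.
Qed.

(** The blocks [E] and [C] change places and everything else keeps its order. *)
Lemma sgn_sswap_r (A C E : finType) : sgn (@sswap_r A C E) = (-1) ^+ (#|C| * #|E|).
Proof.
rewrite /sgn !big_sumType /= [X in X * _ * _]big1 ?mul1r; last first.
  move=> a _; rewrite !big_sumType /= !big1 ?mulr1 // => x _; by rewrite !precE ?prec_anti.
rewrite [X in _ * X]big1 ?mulr1; last first.
  move=> c _; rewrite !big_sumType /= !big1 ?mulr1 // => x _; by rewrite !precE ?prec_anti.
rewrite mulnC -prod_const2; apply: eq_bigr => e _.
rewrite !big_sumType /= [X in X * _](_ : _ = 1) ?mul1r; last first.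
  by rewrite !big1 ?mulr1 // => x _; rewrite !precE ?prec_anti.
by apply: eq_bigr => c _; rewrite !precE.
Qed.

Lemma sgn_sswap_l (A C E : finType) : sgn (@sswap_l A C E) = (-1) ^+ (#|A| * #|C|).
Proof.
rewrite /sgn !big_sumType /= [X in _ * X](_ : _ = 1) ?mulr1; last first.
  rewrite !big1 ?mulr1 // => x _; rewrite !big_sumType /= !big1 ?mulr1 // => y _;
  by rewrite !precE ?prec_anti.
rewrite mulnC -prod_const2; apply: eq_bigr => c _.
rewrite !big_sumType /= [X in X * _]big1 ?mul1r => [|c' _]; last first.
  by rewrite !precE prec_anti.
rewrite [X in _ * X]big1 ?mulr1 => [|e _]; last by rewrite !precE.
by apply: eq_bigr => a _; rewrite !precE.
Qed.

Lemma sgn_unitr (A : finType) :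
  sgn (oapp inl (inr (ord0 : 'I_1)) : option A -> A + 'I_1) = (-1) ^+ #|A|.
Proof.
rewrite /sgn prod_option [X in _ * X]big1 ?mulr1 => [|a _].
  rewrite prod_option /= !precE /= mul1r -prodr_const.
  by apply: eq_bigr => a _; rewrite !precE.
rewrite prod_option /= !precE mul1r.
by apply: big1 => a' _; rewrite !precE prec_anti.
Qed.

Lemma sgn_unlift0 n : @sgn 'I_n.+1 (option 'I_n) (unlift ord0) = 1.
Proof.
apply: sgn_homo => i j; rewrite prec_ord.
by case: (unliftP ord0 i) => [i'|] ->; case: (unliftP ord0 j) => [j'|] ->;
  rewrite !precE.
Qed.

(** The last element becomes [None], hence the first. This is the cost of plugging the last output
    of an upper vertex. *)
Lemma sgn_unlift_max n : @sgn 'I_n.+1 (option 'I_n) (unlift ord_max) = (-1) ^+ n.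
Proof.
have W (i : 'I_n) : widen_ord (leqnSn n) i = lift ord_max i by apply/val_inj/esym/lift_max.
rewrite /sgn big_ord_recr /= [X in _ * X]big1 ?mulr1 => [|a _]; last first.
  by rewrite prec_ord ltnNge -ltnS ltn_ord.
transitivity (\prod_(i < n) (-1 : K)); last by rewrite prodr_const card_ord.
apply: eq_bigr => i _; rewrite big_ord_recr /= W unlift_none liftK prec_None.
rewrite prec_ord lift_max ltn_ord big1 ?mul1r // => j _.
by rewrite W liftK !precE !lift_max -!(@prec_ord n) prec_anti.
Qed.

Lemma sgn_to1 (A : finType) (f : 'I_1 -> A) : sgn f = 1.
Proof. by rewrite /sgn !big_ord1 precE. Qed.

End Sgn.

(** * The polynomial model *)

Section Concentrated.
Variables (K : fieldType) (V : lmodType K) (e : int).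

Definition conc_proj (d : int) (v : V) : V := if d == e then v else 0.

Lemma conc_proj_linear d : linear (conc_proj d).
Proof. by move=> a u v; rewrite /conc_proj; case: (d == e); rewrite ?scaler0 ?addr0. Qed.

HB.instance Definition _ d :=
  GRing.isLinear.Build K V V *:%R (conc_proj d) (conc_proj_linear d).

Lemma conc_projK d d' v :
  conc_proj d (conc_proj d' v) = if d == d' then conc_proj d' v else 0.
Proof.
rewrite /conc_proj; have [->|dd'] := eqVneq d d'; first by case: (d' == e).
by case: (d' =P e) => [<-|_]; rewrite ?(negbTE dd') ?if_same.
Qed.

Lemma conc_sum v : exists2 s : seq int, uniq s & v = \sum_(d <- s) conc_proj d v.
Proof. by exists [:: e] => //; rewrite big_seq1 /conc_proj eqxx. Qed.

Definition concentrated : grmod K :=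
  @GrMod K V (fun d => conc_proj d) conc_projK conc_sum.

Lemma conc_hom d (v : concentrated) : hom d v <-> d = e \/ v = 0.
Proof.
rewrite /hom /= /conc_proj; case: eqP => [->|ne]; first by split; [left|].
by split=> [<-|[/ne //|->]]; first right.
Qed.

End Concentrated.

Section Model.
Variable K : fieldType.

Definition model_op (A B : finType) : grmod K :=
  concentrated {poly K} (#|A|%:Z - 1).

Definition model_act (A A' B B' : finType) (f : A -> A') (g : B -> B')
  (x : model_op A B) : model_op A' B' := sgn K f *: (x : {poly K}).

(* The output [None] comes first in the enumeration of [option A]: moving it past
   the other outputs contributes (-1)^|A|. The remaining factor
   (-1)^(|A|(|C|-1)) is a coboundary, chosen so that combs are sent to monomials
   with coefficient 1. *)
Definition model_comp (A B C D : finType) (x : model_op (option A) B)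
    (y : model_op C (option D)) : model_op (A + C)%type (B + D)%type :=
  (-1) ^+ (#|A| * #|C|) *: ((x : {poly K}) * (y : {poly K})).

Definition model_unit : model_op 'I_1 'I_1 := 1 : {poly K}.

Lemma signr_eq (a b : nat) : odd a = odd b -> (-1) ^+ a = (-1) ^+ b :> K.
Proof. by move=> ab; rewrite -signr_odd ab signr_odd. Qed.

Lemma ksign_card (A C : finType) (a c : int) :
  a = #|A|%:Z - 1 -> c = #|C|%:Z - 1 ->
  ksign K (a * c) = (-1) ^+ (#|A|.+1 * #|C|.+1).
Proof.
(* For an empty set of outputs the degree is -1, whose absolute value still has the parity of
   [n.+1]. *)
have O (n : nat) : odd `|n%:Z - 1| = odd n.+1.
  case: n => [|n] //; rewrite (_ : n.+1%:Z - 1 = n%:Z); last by lia.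
  by rewrite /= negbK.
by move=> -> ->; rewrite /ksign; apply: signr_eq; rewrite abszM !oddM !O.
Qed.

Lemma model_op_hom_cases (A B : finType) d (x : model_op A B) :
  hom d x -> d = #|A|%:Z - 1 \/ x = 0.
Proof. by move/conc_hom. Qed.

Lemma model_act_linear : forall (A A' B B' : finType) (f : A -> A') (g : B -> B'),
    bijective f -> bijective g -> linear (@model_act A A' B B' f g).
Proof. by move=> A A' B B' f g _ _ a x y; rewrite /model_act scalerDr !scalerA mulrC. Qed.

Lemma model_act_hom (A A' B B' : finType) (f : A -> A') (g : B -> B') d (x : model_op A B) :
    bijective f -> bijective g -> hom d x -> hom d (model_act f g x).
Proof.
move=> fB _ /conc_hom H; apply/conc_hom; rewrite -(bij_eq_card fB).
by case: H => [|->]; [left|right; rewrite /model_act scaler0].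
Qed.

Lemma model_act_id (A B : finType) (x : model_op A B) : model_act id id x = x.
Proof. by rewrite /model_act sgn_id scale1r. Qed.

Lemma model_act_comp (A A' A'' B B' B'' : finType)
      (f : A -> A') (f' : A' -> A'') (g : B -> B') (g' : B' -> B'') (x : model_op A B) :
    bijective f -> bijective f' -> bijective g -> bijective g' ->
    model_act (f' \o f) (g' \o g) x = model_act f' g' (model_act f g x).
Proof. by move=> fB f'B _ _; rewrite /model_act sgn_comp // scalerA. Qed.

Lemma model_comp_linearl (A B C D : finType) (y : model_op C (option D)) :
    linear (fun x : model_op (option A) B => model_comp x y).
Proof.
by move=> a x x'; rewrite /model_comp mulrDl scalerDr -scalerAl !scalerA mulrC.
Qed.

Lemma model_comp_linearr (A B C D : finType) (x : model_op (option A) B) :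
    linear (fun y : model_op C (option D) => model_comp x y).
Proof.
by move=> a y y'; rewrite /model_comp mulrDr scalerDr -scalerAr !scalerA mulrC.
Qed.

Lemma model_comp_hom (A B C D : finType)
      (x : model_op (option A) B) (y : model_op C (option D)) d e :
    hom d x -> hom e y -> hom (d + e) (model_comp x y).
Proof.
move=> /conc_hom[->|->] /conc_hom[->|->]; apply/conc_hom; rewrite /model_comp;
  rewrite ?mul0r ?mulr0 ?scaler0; try by right.
left; rewrite card_option card_sum PoszD -addn1 PoszD; lia.
Qed.

Lemma model_comp_act (A A' B B' C C' D D' : finType)
      (f : A -> A') (g : B -> B') (h : C -> C') (k : D -> D')
      (x : model_op (option A) B) (y : model_op C (option D)) :
    bijective f -> bijective g -> bijective h -> bijective k ->
    model_comp (model_act (omap f) g x) (model_act h (omap k) y)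
    = model_act (smap f h) (smap g k) (model_comp x y).
Proof.
move=> fB _ hB _; rewrite /model_comp /model_act sgn_omap sgn_smap -(bij_eq_card fB).
by rewrite -(bij_eq_card hB) -scalerAl -scalerAr !scalerA -mulrA mulrC.
Qed.

Lemma model_unit_hom : hom 0 model_unit.
Proof. by apply/conc_hom; left; rewrite card_ord. Qed.

Lemma model_comp_unitl (C D : finType) (y : model_op C (option D)) :
    model_comp (model_act (unlift (ord0 : 'I_1)) id model_unit) y
    = model_act inr (oapp inr (inl ord0)) y.
Proof.
rewrite /model_comp /model_act /model_unit sgn_to1 scale1r card_ord mul0n expr0 scale1r mul1r.
by rewrite sgn_homo ?scale1r // => c c'; rewrite precE.
Qed.

Lemma model_comp_unitr (A B : finType) (x : model_op (option A) B) :
    model_comp x (model_act id (unlift (ord0 : 'I_1)) model_unit)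
    = model_act (oapp inl (inr ord0)) inl x.
Proof.
by rewrite /model_comp /model_act /model_unit sgn_id scale1r card_ord muln1 mulr1 sgn_unitr.
Qed.

Lemma model_comp_seq (A B C D E F : finType) (x : model_op (option A) B)
      (y : model_op (option C) (option D)) (z : model_op E (option F)) :
    model_act (@sassoc _ _ _) (@sassoc _ _ _)
      (model_comp (model_act (@opull_r _ _) id (model_comp x y)) z)
    = model_comp x (model_act id (@opull_l _ _) (model_comp y z)).
Proof.
rewrite /model_comp /model_act sgn_sassoc sgn_id sgn_opull_r !scale1r.
rewrite -?scalerAl -?scalerAr !scalerA -!exprD mulrA; congr (_ *: _).
apply: signr_eq; rewrite !oddD !oddM !card_sum !card_option !oddD /=.
by case: (odd #|A|); case: (odd #|C|); case: (odd #|E|).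
Qed.

(** Unless both sides vanish, [y] and [z] have degrees |C| - 1 and |E| - 1. Modulo 2 the Koszul sign
    then cancels against the exchange of the blocks [C] and [E], the exchange of the two plugged
    outputs and the change in the coboundary factors. *)
Lemma model_comp_parout (A B C D E F : finType) (x : model_op (option (option A)) B)
      (y : model_op C (option D)) (z : model_op E (option F)) d e :
    hom d y -> hom e z ->
    model_comp (model_act (@opull_l _ _) id (model_comp x y)) z
    = ksign K (d * e) *: model_act (@sswap_r _ _ _) (@sswap_r _ _ _)
        (model_comp (model_act (@opull_l _ _) id (model_comp (model_act (@oswap _) id x) z)) y).
Proof.
move=> /model_op_hom_cases[dE|->]; last first.
  by rewrite /model_comp /model_act !(mulr0, mul0r, scaler0).
move=> /model_op_hom_cases[eE|->]; last first.
  by rewrite /model_comp /model_act !(mulr0, mul0r, scaler0).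
rewrite (ksign_card dE eE) /model_comp /model_act sgn_sswap_r sgn_oswap !sgn_opull_l !scale1r.
rewrite -?scalerAl -?scalerAr !scalerA -!exprD -exprSr -!exprD.
rewrite -!mulrA [(z : {poly K}) * _]mulrC; congr (_ *: _).
apply: signr_eq; rewrite !(oddD, oddS, oddM, card_sum, card_option) /=.
by case: (odd #|A|); case: (odd #|C|); case: (odd #|E|).
Qed.

(** Here [oswap] exchanges inputs, which carry no sign; the Koszul sign is balanced by the output
    blocks, the [opull_r] on inputs being free as well. *)
Lemma model_comp_parin (A B C D E F : finType) (x : model_op (option A) B)
      (y : model_op (option C) D) (z : model_op E (option (option F))) d e :
    hom d x -> hom e y ->
    model_comp x (model_act id (@opull_r _ _) (model_comp y z))
    = ksign K (d * e) *: model_act (@sswap_l _ _ _) (@sswap_l _ _ _)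
        (model_comp y (model_act id (@opull_r _ _) (model_comp x (model_act id (@oswap _) z)))).
Proof.
move=> /model_op_hom_cases[dE|->]; last first.
  by rewrite /model_comp /model_act !(mulr0, mul0r, scaler0).
move=> /model_op_hom_cases[eE|->]; last first.
  by rewrite /model_comp /model_act !(mulr0, mul0r, scaler0).
rewrite (ksign_card dE eE) /model_comp /model_act sgn_sswap_l !sgn_id !scale1r.
rewrite -?scalerAl -?scalerAr !scalerA -!exprD.
rewrite mulrCA; congr (_ *: _).
apply: signr_eq; rewrite !(oddD, oddS, oddM, card_sum, card_option) /=.
by case: (odd #|A|); case: (odd #|C|); case: (odd #|E|).
Qed.

Definition model : dioperad K :=
  @Dioperad K model_op model_act model_comp model_unit model_act_linear model_act_hom model_act_id model_act_comp
    model_comp_linearl model_comp_linearr model_comp_hom model_comp_act model_unit_hom model_comp_unitl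
    model_comp_unitr model_comp_seq model_comp_parout model_comp_parin.

End Model.

(** * Values of the polynomial model on monomials, combs and two-vertex graphs *)

Section CombS.
Variables (K : fieldType) (P : dioperad K).
Variables (l : P 'I_1 'I_2) (del : 'I_2 -> P 'I_2 'I_1).

Lemma iter_prodS n : iter_prod l n.+1 =
  dact (fun _ => ord0)
       (fun u : 'I_n.+1 + 'I_1 => inord
          match u with inl a => a : nat | inr b => (n.+1 + b)%N end)
       (graft ord0 ord0 (iter_prod l n) l).
Proof. by []. Qed.

Lemma combS n p t : comb l del n p t.+1 =
  dact (fun u : 'I_t + 'I_2 => inord
          match u with inl a => a.+2 | inr b => b : nat end)
       (fun u : 'I_n.+1 + 'I_0 => match u with inl b => b | inr _ => ord0 end)
       (graft ord0 ord0 (comb l del n p t)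
          (del (if (t < p)%N then ord0 else ord_max))).
Proof. by []. Qed.

End CombS.

Section ModelValues.
Variable K : fieldType.
Local Notation M := (model K).

Definition model_l : M 'I_1 'I_2 := 1 : {poly K}.
Definition model_del (x : 'I_2) : M 'I_2 'I_1 := 'X^x : {poly K}.

Lemma model_actE (A A' B B' : finType) (f : A -> A') (g : B -> B') (x : M A B) :
  dact f g x = sgn K f *: (x : {poly K}) :> {poly K}.
Proof. by []. Qed.

Lemma model_graft0E j k p q i (x : M 'I_j.+1 'I_k) (y : M 'I_p 'I_q.+1) :
  graft ord0 i x y
  = (-1) ^+ (j * p) *: ((x : {poly K}) * (y : {poly K})) :> {poly K}.
Proof.
rewrite /graft /= /model_comp /model_act. set c := sgn K _; have -> : c = 1 := sgn_unlift0 K j.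
by rewrite sgn_id !scale1r !card_ord.
Qed.

Lemma model_graft_maxE j k p q i (x : M 'I_j.+1 'I_k) (y : M 'I_p 'I_q.+1) :
  graft ord_max i x y
  = (-1) ^+ (j + j * p) *: ((x : {poly K}) * (y : {poly K})) :> {poly K}.
Proof.
rewrite /graft /= /model_comp /model_act; set c := sgn K _.
have -> : c = (-1) ^+ j := sgn_unlift_max K j; rewrite sgn_id !scale1r.
by rewrite -scalerAl scalerA !card_ord -exprD addnC.
Qed.

Lemma sgn_rev2 : sgn K (@rev_ord 2) = -1.
Proof.
rewrite /sgn !big_ord_recl !big_ord0 !precE /=.
by rewrite /inv_sign /= !mulr1 ?mul1r.
Qed.

Lemma model_mono_ll w : mono_ll model_l w = 1 :> {poly K}.
Proof.
rewrite /mono_ll model_actE model_graft0E /= mul0n expr0 scale1r mulr1.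
by rewrite sgn_homo ?scale1r // => -[[]|i] // [[]|j] //; rewrite !ord1 !precE.
Qed.

Lemma model_mono_dd w : mono_dd model_del w = 'X^(w.1.1 + w.1.2) :> {poly K}.
Proof.
rewrite /mono_dd model_actE model_graft0E /= scalerA -exprD.
rewrite [X in X *: _](_ : _ = 1) ?scale1r //.
rewrite sqrrN expr1n mulr1 /sgn big_sumType /= !big_ord_recl !big_ord0.
rewrite !big_sumType /= !big_ord_recl !big_ord0 !precE.
by case: w => -[? ?] [[|[|[|?]]] ?] //=; rewrite /inv_sign /= ?(mulr1, mul1r, mulrNN).
Qed.

(** Up to an overall -1, these are the coefficients of relation (d) after the desuspension signs of
    [koszul_dual]. *)
Definition ld_sign (o : option ('I_2 * 'I_2)) : K :=
  if o is Some (_, k) then (if k == ord0 then 1 else -1) else 1.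

Lemma model_mono_ld w :
  mono_ld model_l model_del w = ld_sign w.2 *: 'X^(w.1) :> {poly K}.
Proof.
case: w => x [[i k]|].
  rewrite [LHS]model_actE model_graft_maxE scalerA; congr (_ *: _); last by rewrite mulr1.
  rewrite sqrrN expr1n mulr1 /sgn big_sumType /= !big_ord1.
  rewrite !big_sumType /= !big_ord1 !precE.
  by case: k => [[|[|?]] ?] //=; rewrite /inv_sign /= ?(mulr1, mul1r, mulrNN).
rewrite [LHS]model_actE model_graft0E scalerA; congr (_ *: _); last by rewrite mul1r.
rewrite mul0n expr0 mulr1 sgn_homo // => -[[]|a] // [[]|b] //; by rewrite !precE.
Qed.

Lemma model_is_model : is_model (koszul_dual (LieBi K)) model_l model_del.
Proof.
split.
- by apply/conc_hom; left; rewrite card_ord.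
- by move=> x; apply/conc_hom; left; rewrite card_ord.
- by rewrite model_actE sgn_id scale1r.
- by move=> x; rewrite model_actE sgn_rev2 scaleN1r.
- move=> u /(_ [ffun=> 1] erefl) H.
  rewrite (eq_bigr (fun w => u w *: (1 : {poly K}))) => [|w _]; last first.
    by congr (_ *: _); apply: model_mono_ll.
  rewrite -scaler_suml (_ : \sum_w u w = 0) ?scale0r //.
  (* The product has degree 1 in [LieBi], so desuspension multiplies relation (a) by -1. *)
  apply/eqP; rewrite -oppr_eq0 -sumrN; apply/eqP; rewrite -[RHS]H.
  by apply: eq_bigr => w _; rewrite ffunE mulr1 mulN1r.
- move=> u H.
  rewrite (eq_bigr (fun w => u w *: ('X^(w.1.1 + w.1.2) : {poly K}))) => [|w _]; last first.
    by congr (_ *: _); apply: model_mono_dd.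
  apply/polyP => i; rewrite coef_sum coef0.
  (* The coefficients of ['X^i] on the monomials form relation (b) for i = 0 and i = 2, relation (c)
     for i = 1, and vanish otherwise. *)
  pose r (w : 'I_2 * 'I_2 * 'I_3) : K := (i == (w.1.1 + w.1.2)%N)%:R.
  have Hr : (exists x : 'I_2, r =1 fun w => ((w.1.1 == x) && (w.1.2 == x))%:R) \/
     (r =1 fun w => (w.1.1 != w.1.2)%:R) \/ r =1 fun=> 0.
    rewrite /r; case: i {r} => [|[|[|i]]].
    + by left; exists ord0 => -[[[[|[|?]] ?] [[|[|?]] ?]] ?] //=.
    + by right; left => -[[[[|[|?]] ?] [[|[|?]] ?]] ?] //=.
    + by left; exists ord_max => -[[[[|[|?]] ?] [[|[|?]] ?]] ?] //=.
    + by right; right => -[[[[|[|?]] ?] [[|[|?]] ?]] ?] //=.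
  under eq_bigr do rewrite coefZ coefXn -/(r _).
  case: Hr => [[x Hx]|[Hx|H0]].
  + rewrite -[RHS](H _ (or_introl (ex_intro _ x erefl))).
    by apply: eq_bigr => w _; rewrite Hx ffunE [ksign _ _]expr0 mul1r mulrC.
  + rewrite -[RHS](H _ (or_intror erefl)).
    by apply: eq_bigr => w _; rewrite Hx ffunE [ksign _ _]expr0 mul1r mulrC.
  + by apply: big1 => w _; rewrite H0 mulr0.
- move=> u H.
  rewrite (eq_bigr (fun w => u w *: (ld_sign w.2 *: 'X^(w.1) : {poly K}))) => [|w _]; last first.
    by congr (_ *: _); apply: model_mono_ld.
  apply/polyP => i; rewrite coef_sum coef0.
  (* For i < 2 the coefficient of ['X^i] isolates the relation (d) of the cooperation of kind i. *)
  have [i2|i2] := ltnP i 2; last first.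
    apply: big1 => -[x o] _; rewrite !coefZ coefXn gtn_eqF ?mulr0 //=.
    exact: leq_trans i2.
  apply/eqP; rewrite -oppr_eq0 -sumrN; apply/eqP.
  rewrite -[RHS](H _ (ex_intro _ (Ordinal i2) erefl)).
  apply: eq_bigr => -[x o] _; rewrite !coefZ coefXn ffunE /=.
  rewrite (_ : (i == x) = (x == Ordinal i2)); last by rewrite eq_sym.
  case: eqP => _ /=; rewrite ?mulr0 ?oppr0 ?mul0r //.
  by case: o => [[a k]|] /=; rewrite /ksign /= ?(mul1r, mulr1, mulN1r) //;
    case: eqP; rewrite ?(mul1r, mulr1, mulN1r, mulrN1, opprK).
Qed.

Lemma model_iter_prod n : iter_prod model_l n = 1 :> {poly K}.
Proof.
elim: n => [|n IH] //; rewrite iter_prodS model_actE model_graft0E IH mul0n expr0 mulr1 scale1r.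
by rewrite sgn_homo ?scale1r // => -[[]|i] // [[]|j] //; rewrite !ord1 !precE.
Qed.

(** No sign arises: a cooperation has two outputs, so both the coboundary factor and the passage of
    the older outputs behind the new ones contribute even exponents. *)
Lemma model_comb n p t : comb model_l model_del n p t = 'X^(t - p) :> {poly K}.
Proof.
elim: t => [|t IH]; first by rewrite /= model_iter_prod sub0n.
rewrite combS model_actE model_graft0E IH scalerA.
rewrite mulnC exprM sqrrN !expr1n mulr1 (_ : sgn _ _ = 1) ?scale1r.
  rewrite /model_del; case: ltnP => tp; rewrite -exprD; congr ('X^_) => /=; lia.
have Il (a : 'I_t) : (inord a.+2 : 'I_t.+2) = a.+2 :> nat by rewrite inordK // !ltnS.
have Ir (b : 'I_2) : (inord b : 'I_t.+2) = b :> nat.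
  by rewrite inordK //; apply: leq_trans (ltn_ord b) _.
rewrite /sgn !big_sumType /= big1 => [|a _]; last first.
  rewrite big_sumType /= [X in X * _]big1 ?mul1r => [|a' _].
  - rewrite (eq_bigr (fun=> -1)) => [|b _].
      by rewrite prodr_const card_ord sqrrN expr1n.
    by rewrite !precE Il Ir (leq_trans (ltn_ord b)).
  - by rewrite !precE !Il !ltnS -!(@prec_ord t) prec_anti.
rewrite mul1r big1 // => b _; rewrite big_sumType /= !big1 ?mul1r // => b' _.
  by rewrite !precE !Ir -!(@prec_ord 2) prec_anti.
by rewrite !precE.
Qed.

Lemma model_two_vertexE m n (j : 'I_m) (k : 'I_n.+1) (s : 'S_m) (t : 'S_n)
    (x : M 'I_j.+1 'I_k) (y : M 'I_(m - j) 'I_(n - k).+1) :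
  two_vertex s t x y
  = (-1) ^+ (odd_perm s + (j + j * (m - j))) *: ((x : {poly K}) * (y : {poly K})) :> {poly K}.
Proof.
rewrite /two_vertex model_actE model_graft_maxE scalerA; congr (_ *: _).
rewrite [RHS]exprD; congr (_ * _).
(* [spread] is [s] after the order-preserving identification [c], which has sign 1. *)
pose c u := cast_ord (subnKC (ltnW (ltn_ord j))) (unsplit u).
rewrite -sgn_perm -[RHS]mulr1 -(@sgn_homo K _ _ c).
  rewrite -sgn_comp; last exact: perm_bij.
    exact: eq_sgn.
  apply: bij_comp.
    by exists (cast_ord (esym (subnKC (ltnW (ltn_ord j))))) => i; rewrite ?cast_ordK ?cast_ordKV.
  by exists (@fintype.split _ _); [exact: unsplitK|exact: fintype.splitK].
move=> [a|a] [b|b]; rewrite !precE /c /= ?ltn_add2l //.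
  by rewrite (leq_trans (ltn_ord a)) ?leq_addr.
by rewrite ltnNge (leq_trans (ltnW (ltn_ord b))) ?leq_addr.
Qed.

End ModelValues.

(** * Bijectivity of the structure maps *)

Lemma omap_bij (A A' : Type) (f : A -> A') : bijective f -> bijective (omap f).
Proof. by case=> g fK gK; exists (omap g) => -[x|] //=; rewrite ?fK ?gK. Qed.

Lemma smap_bij (A A' B B' : Type) (f : A -> A') (g : B -> B') :
  bijective f -> bijective g -> bijective (smap f g).
Proof.
by case=> f' fK f'K [g' gK g'K]; exists (smap f' g') => -[x|x] /=;
  rewrite ?fK ?f'K ?gK ?g'K.
Qed.

Lemma id_bij (A : Type) : bijective (@id A).
Proof. by exists id. Qed.

Lemma oswap_bij (A : Type) : bijective (@oswap A).
Proof. by exists (@oswap A) => -[[a|]|]. Qed.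

Lemma opull_r_bij (A C : Type) : bijective (@opull_r A C).
Proof.
exists (fun u => match u with
  | None => inr None | Some (inl a) => inl a | Some (inr c) => inr (Some c) end).
  by case=> [a|[c|]].
by case=> [[a|c]|].
Qed.

Lemma opull_l_bij (A C : Type) : bijective (@opull_l A C).
Proof.
exists (fun u => match u with
  | None => inl None | Some (inl a) => inl (Some a) | Some (inr c) => inr c end).
  by case=> [[a|]|c].
by case=> [[a|c]|].
Qed.

Lemma sassoc_bij (A C E : Type) : bijective (@sassoc A C E).
Proof.
exists (fun u => match u with
  | inl a => inl (inl a) | inr (inl c) => inl (inr c) | inr (inr e) => inr e end).
  by case=> [[a|c]|e].
by case=> [a|[c|e]].
Qed.

Lemma sswap_r_bij (A C E : Type) : bijective (@sswap_r A C E).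
Proof. by exists (@sswap_r A E C) => -[[a|c]|e]. Qed.

Lemma sswap_l_bij (A C E : Type) : bijective (@sswap_l A C E).
Proof. by exists (@sswap_l C A E) => -[a|[c|e]]. Qed.

Lemma unlift_bij n (i : 'I_n.+1) : bijective (unlift i : 'I_n.+1 -> option 'I_n).
Proof.
exists (fun u => if u is Some j then lift i j else i).
  by move=> j; case: unliftP.
by case=> [j|]; rewrite ?liftK ?unlift_none.
Qed.

Lemma inr0_bij (C : Type) : bijective (inr : C -> 'I_0 + C).
Proof. by exists (fun u : 'I_0 + C => match u with inl (Ordinal _ lt0) => match notF lt0 with end | inr c => c end) => [|[[]|]]. Qed.

Lemma inl0_bij (C : Type) : bijective (inl : C -> C + 'I_0).
Proof. by exists (fun u : C + 'I_0 => match u with inr (Ordinal _ lt0) => match notF lt0 with end | inl c => c end) => [|[|[]]]. Qed.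

Lemma unitl_bij (D : Type) :
  bijective (oapp inr (inl (ord0 : 'I_1)) : option D -> 'I_1 + D).
Proof.
exists (fun u => if u is inr d then Some d else None); first by case.
by case=> [i|d] //=; rewrite [i]ord1.
Qed.

Lemma unitr_bij (A : Type) :
  bijective (oapp inl (inr (ord0 : 'I_1)) : option A -> A + 'I_1).
Proof.
exists (fun u => if u is inl d then Some d else None); first by case.
by case=> [d|i] //=; rewrite [i]ord1.
Qed.

Lemma rev_ord_bij n : bijective (@rev_ord n).
Proof. by exists (@rev_ord n); exact: rev_ordK. Qed.

Lemma mono_ll_out_bij : bijective ((fun=> ord0) : 'I_0 + 'I_1 -> 'I_1).
Proof.
by apply: inj_card_bij => [[[]|i] [[]|j]//|]; rewrite ?card_sum ?card_ord // !ord1.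
Qed.

Lemma cyc_inj w (i j : nat) : (i < 3)%N -> (j < 3)%N -> cyc w i = cyc w j -> i = j.
Proof.
move=> i3 j3 /(congr1 val) /=/eqP.
by rewrite eqn_modDl !modn_small // => /eqP.
Qed.

Lemma mono_ll_in_bij w : bijective (fun u : 'I_2 + 'I_1 =>
  match u with inl a => cyc w a | inr _ => cyc w 2 end).
Proof.
apply: inj_card_bij => [|]; last by rewrite card_sum !card_ord.
move=> [a|a] [b|b] /cyc_inj H.
- by congr inl; apply/val_inj/H; apply: leq_trans (ltn_ord _) _.
- have := H (leq_trans (ltn_ord a) (leqnSn 2)) isT.
  by move=> ab; have := ltn_ord a; rewrite [nat_of_ord a]ab.
- have := H isT (leq_trans (ltn_ord b) (leqnSn 2)).
  by move=> ab; have := ltn_ord b; rewrite -[nat_of_ord b]ab.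
- by rewrite !ord1.
Qed.

Lemma mono_dd_out_bij w : bijective (fun u : 'I_1 + 'I_2 =>
  match u with inl _ => cyc w 2 | inr b => cyc w b end).
Proof.
have B : bijective (fun u : 'I_1 + 'I_2 =>
    match u with inl a => inr a | inr b => inl b end : 'I_2 + 'I_1).
  by exists (fun u => match u with inl a => inr a | inr b => inl b end) => -[].
by apply: (eq_bij (bij_comp (mono_ll_in_bij w) B)) => -[].
Qed.

Lemma mono_dd_in_bij : bijective ((fun=> ord0) : 'I_1 + 'I_0 -> 'I_1).
Proof.
by apply: inj_card_bij => [[i|[]//] [j|[]//]|]; rewrite ?card_sum ?card_ord // !ord1.
Qed.

Lemma join0_bij n (i : 'I_n.+1) :
  bijective (fun u : 'I_0 + 'I_n.+1 => match u with inl _ => i | inr b => b end).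
Proof. by apply: (bij_can_bij (inr0_bij _)). Qed.

Lemma joinr0_bij n (i : 'I_n.+1) :
  bijective (fun u : 'I_n.+1 + 'I_0 => match u with inl b => b | inr _ => i end).
Proof. by apply: (bij_can_bij (inl0_bij _)). Qed.

Lemma mono_ld_bij (k : 'I_2) : bijective (fun u : 'I_1 + 'I_1 =>
  match u with inl _ => k | inr _ => rev_ord k end).
Proof.
have N : k != rev_ord k by case: k => [[|[|]]].
apply: inj_card_bij => [|]; last by rewrite card_sum !card_ord.
by move=> [a|a] [b|b] // e; rewrite ?ord1 //; case/eqP: N.
Qed.

Lemma iter_prod_in_bij n : bijective (fun u : 'I_n.+1 + 'I_1 => inord
  match u with inl a => a : nat | inr b => (n.+1 + b)%N end : 'I_n.+2).
Proof.
apply: inj_card_bij => [|]; last by rewrite card_sum !card_ord addn1.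
have H m m' : (m < n.+2)%N -> (m' < n.+2)%N -> inord m = inord m' :> 'I_n.+2 -> m = m'.
  by move=> mn m'n /(congr1 val) /=; rewrite !inordK.
have I (a : 'I_n.+1) : (a < n.+2)%N by apply: ltnW; rewrite ltnS.
have J (a : 'I_1) : (n.+1 + a < n.+2)%N by rewrite ord1 addn0.
move=> [a|a] [b|b].
- by move/(H _ _ (I a) (I b)) => e; congr inl; apply/val_inj.
- by move/(H _ _ (I a) (J b)) => e; have := ltn_ord a; rewrite e ltnNge leq_addr.
- by move/(H _ _ (J a) (I b)) => e; have := ltn_ord b; rewrite -e ltnNge leq_addr.
- by rewrite !ord1.
Qed.

Lemma comb_out_bij t : bijective (fun u : 'I_t + 'I_2 => inord
  match u with inl a => a.+2 | inr b => b : nat end : 'I_t.+2).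
Proof.
apply: inj_card_bij => [|]; last by rewrite card_sum !card_ord addn2.
have H m m' : (m < t.+2)%N -> (m' < t.+2)%N -> inord m = inord m' :> 'I_t.+2 -> m = m'.
  by move=> mn m'n /(congr1 val) /=; rewrite !inordK.
have I (b : 'I_2) : (b < t.+2)%N by apply: leq_trans (ltn_ord b) _.
have J (a : 'I_t) : (a.+2 < t.+2)%N by rewrite !ltnS.
move=> [a|a] [b|b].
- by move/(H _ _ (J a) (J b)) => -[e]; congr inl; apply/val_inj.
- by move/(H _ _ (J a) (I b)) => e; have := ltn_ord b; rewrite -e.
- by move/(H _ _ (I a) (J b)) => e; have := ltn_ord a; rewrite e.
- by move/(H _ _ (I a) (I b)) => e; congr inr; apply/val_inj.
Qed.

(** * Naturality of monomials and combs under morphisms *)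

Section Morphism.
Variables (K : fieldType) (P Q : dioperad K) (f : forall A B : finType, P A B -> Q A B).
Hypothesis fM : is_dmorphism f.
Variables (l : P 'I_1 'I_2) (del : 'I_2 -> P 'I_2 'I_1).

Lemma dmor_graft j k p q (o : 'I_j.+1) (i : 'I_q.+1) (x : P 'I_j.+1 'I_k)
  (y : P 'I_p 'I_q.+1) : f (graft o i x y) = graft o i (f x) (f y).
Proof.
rewrite /graft (dmor_comp fM) !(dmor_act fM) //;
  by [exact: unlift_bij | exact: id_bij].
Qed.

Lemma dmor_mono_ll w : f (mono_ll l w) = mono_ll (f l) w.
Proof.
rewrite /mono_ll (dmor_act fM) ?dmor_graft //.
  exact: mono_ll_out_bij.
exact: mono_ll_in_bij.
Qed.

Lemma dmor_mono_dd w : f (mono_dd del w) = mono_dd (fun x => f (del x)) w.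
Proof.
rewrite /mono_dd (dmor_act fM) ?dmor_graft //.
  exact: mono_dd_out_bij.
exact: mono_dd_in_bij.
Qed.

Lemma dmor_mono_ld w : f (mono_ld l del w) = mono_ld (f l) (fun x => f (del x)) w.
Proof.
case: w => x [[i k]|]; rewrite /mono_ld /= (dmor_act fM) ?dmor_graft //.
- exact: mono_ld_bij.
- exact: mono_ld_bij.
- exact: join0_bij.
- exact: joinr0_bij.
Qed.

Lemma dmor_iter_prod n : f (iter_prod l n) = iter_prod (f l) n.
Proof.
elim: n => [|n IH]; first exact: dmor_unit.
rewrite !iter_prodS (dmor_act fM) ?dmor_graft ?IH //.
  exact: mono_ll_out_bij.
exact: iter_prod_in_bij.
Qed.

Lemma dmor_comb n p t : f (comb l del n p t) = comb (f l) (fun x => f (del x)) n p t.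
Proof.
elim: t => [|t IH]; first exact: dmor_iter_prod.
rewrite !combS (dmor_act fM) ?dmor_graft ?IH //.
  exact: comb_out_bij.
exact: joinr0_bij.
Qed.

Lemma dmorZD A B a (x y : P A B) : f (a *: x + y) = a *: f x + f y.
Proof. exact: (dmor_linear fM). Qed.

Lemma dmor0 A B : f (0 : P A B) = 0.
Proof. by have := dmorZD (-1) (0 : P A B) 0; rewrite scaler0 addr0 scaleN1r addNr. Qed.

Lemma dmorD A B (x y : P A B) : f (x + y) = f x + f y.
Proof. by rewrite -[x]scale1r dmorZD !scale1r. Qed.

Lemma dmorZ A B a (x : P A B) : f (a *: x) = a *: f x.
Proof. by rewrite -[a *: x]addr0 dmorZD dmor0 addr0. Qed.

Lemma dmor_sum A B I (r : seq I) (F : I -> P A B) :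
  f (\sum_(i <- r) F i) = \sum_(i <- r) f (F i).
Proof. by elim/big_rec2: _ => [|i y x _ <-]; rewrite ?dmor0 ?dmorD. Qed.

End Morphism.

(** * Induction principle for presented dioperads *)

(** The closure conditions under which the chosen elements again form a dioperad; stability under
    [gr_proj] is what makes its components graded modules. *)
Record closed_family (K : fieldType) (Q : dioperad K) := ClosedFamily {
  cf_pred :> forall A B : finType, Q A B -> Prop;
  cf_0 : forall A B : finType, cf_pred (0 : Q A B);
  cf_lin : forall (A B : finType) a (x y : Q A B),
    cf_pred x -> cf_pred y -> cf_pred (a *: x + y);
  cf_proj : forall (A B : finType) d (x : Q A B),
    cf_pred x -> cf_pred (gr_proj (Q A B) d x);
  cf_act : forall (A A' B B' : finType) (f : A -> A') (g : B -> B') (x : Q A B),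
    bijective f -> bijective g -> cf_pred x -> cf_pred (dact f g x);
  cf_comp : forall (A B C D : finType) (x : Q (option A) B) (y : Q C (option D)),
    cf_pred x -> cf_pred y -> cf_pred (dcomp x y);
  cf_unit : cf_pred (dunit Q)
}.

Section SubDioperad.
Variables (K : fieldType) (Q : dioperad K) (V : closed_family Q).

Definition sub_pred (A B : finType) : {pred Q A B} := [pred x | `[< V A B x >]].

Lemma sub_predP (A B : finType) (x : Q A B) : reflect (V A B x) (x \in @sub_pred A B).
Proof. exact: asboolP. Qed.

Section Carrier.
Variables A B : finType.

Lemma sub_pred_closed : submod_closed (@sub_pred A B).
Proof.
split=> [|a x y /sub_predP Vx /sub_predP Vy]; apply/sub_predP; first exact: cf_0.
exact: cf_lin.
Qed.

HB.instance Definition _ :=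
  GRing.isSubmodClosed.Build K (Q A B) (@sub_pred A B) sub_pred_closed.

Record sub_op := SubOp { sub_val :> Q A B; _ : sub_val \in @sub_pred A B }.

HB.instance Definition _ := [isSub for sub_val].
HB.instance Definition _ := [Choice of sub_op by <:].
HB.instance Definition _ := [SubChoice_isSubLmodule of sub_op by <:].

Lemma sub_opP (x : sub_op) : V A B (sub_val x).
Proof. by case: x => x /= /sub_predP. Qed.

Lemma sub_val_inj (x y : sub_op) : sub_val x = sub_val y -> x = y.
Proof. exact: val_inj. Qed.

Definition mk_sub (x : Q A B) (Vx : V A B x) : sub_op := SubOp (introT (sub_predP x) Vx).

Definition sub_proj (d : int) (x : sub_op) : sub_op := mk_sub (cf_proj d (sub_opP x)).

Lemma sub_proj_linear d : linear (sub_proj d).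
Proof. by move=> a x y; apply: sub_val_inj => /=; rewrite linearP. Qed.

HB.instance Definition _ d :=
  GRing.isLinear.Build K sub_op sub_op *:%R (sub_proj d) (sub_proj_linear d).

Lemma sub_projK d e v :
  sub_proj d (sub_proj e v) = if d == e then sub_proj e v else 0.
Proof.
by apply: sub_val_inj => /=; rewrite gr_projK; case: ifP.
Qed.

Lemma sub_sum v : exists2 s : seq int, uniq s & v = \sum_(d <- s) sub_proj d v.
Proof.
have [s us E] := gr_sum (sub_val v); exists s => //; apply: sub_val_inj.
by rewrite [RHS](raddf_sum val).
Qed.

Definition sub_grmod : grmod K :=
  @GrMod K sub_op (fun d => sub_proj d) sub_projK sub_sum.

Lemma sub_homP d (x : sub_grmod) : hom d x <-> hom d (sub_val x).
Proof. by split=> [/(congr1 sub_val)|H]; last apply: sub_val_inj. Qed.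

End Carrier.

(** [dact] is total, while [cf_act] covers only bijections. The value 0 elsewhere is harmless, since
    the axioms restrict relabellings to bijections. *)
Definition sub_dact (A A' B B' : finType) (f : A -> A') (g : B -> B')
    (x : sub_grmod A B) : sub_grmod A' B' :=
  match pselect (bijective f /\ bijective g) with
  | left fg => mk_sub (cf_act fg.1 fg.2 (sub_opP x))
  | right _ => 0
  end.

Lemma sub_dactE (A A' B B' : finType) (f : A -> A') (g : B -> B') (x : sub_grmod A B) :
  bijective f -> bijective g -> sub_val (sub_dact f g x) = dact f g (sub_val x).
Proof. by move=> fB gB; rewrite /sub_dact; case: pselect => // -[]. Qed.

Definition sub_dcomp (A B C D : finType) (x : sub_grmod (option A) B)
    (y : sub_grmod C (option D)) : sub_grmod (A + C)%type (B + D)%type :=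
  mk_sub (cf_comp (sub_opP x) (sub_opP y)).

Definition sub_dunit : sub_grmod 'I_1 'I_1 := mk_sub (cf_unit V).

Lemma sub_dact_linear (A A' B B' : finType) (f : A -> A') (g : B -> B') :
  bijective f -> bijective g -> linear (@sub_dact A A' B B' f g).
Proof.
by move=> fB gB a x y; apply: sub_val_inj; rewrite sub_dactE //= !sub_dactE // dact_linear.
Qed.

Lemma sub_dact_hom (A A' B B' : finType) (f : A -> A') (g : B -> B') d
    (x : sub_grmod A B) :
  bijective f -> bijective g -> hom d x -> hom d (sub_dact f g x).
Proof.
move=> fB gB /sub_homP dx; apply/sub_homP; rewrite sub_dactE //; exact: dact_hom.
Qed.

Lemma sub_dact_id (A B : finType) (x : sub_grmod A B) : sub_dact id id x = x.
Proof. by apply: sub_val_inj; rewrite sub_dactE ?dact_id //; apply: id_bij. Qed.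

Lemma sub_dact_comp (A A' A'' B B' B'' : finType)
    (f : A -> A') (f' : A' -> A'') (g : B -> B') (g' : B' -> B'') (x : sub_grmod A B) :
  bijective f -> bijective f' -> bijective g -> bijective g' ->
  sub_dact (f' \o f) (g' \o g) x = sub_dact f' g' (sub_dact f g x).
Proof.
move=> fB f'B gB g'B; apply: sub_val_inj.
rewrite (sub_dactE _ (bij_comp f'B fB) (bij_comp g'B gB)) [RHS](sub_dactE _ f'B g'B).
by rewrite sub_dactE //; exact: dact_comp.
Qed.

Lemma sub_dcomp_linearl (A B C D : finType) (y : sub_grmod C (option D)) :
  linear (fun x : sub_grmod (option A) B => sub_dcomp x y).
Proof. by move=> a x x'; apply: sub_val_inj; rewrite /= dcomp_linearl. Qed.

Lemma sub_dcomp_linearr (A B C D : finType) (x : sub_grmod (option A) B) :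
  linear (fun y : sub_grmod C (option D) => sub_dcomp x y).
Proof. by move=> a y y'; apply: sub_val_inj; rewrite /= dcomp_linearr. Qed.

Lemma sub_dcomp_hom (A B C D : finType)
    (x : sub_grmod (option A) B) (y : sub_grmod C (option D)) d e :
  hom d x -> hom e y -> hom (d + e) (sub_dcomp x y).
Proof. move=> /sub_homP dx /sub_homP ey; apply/sub_homP; exact: dcomp_hom. Qed.

Lemma sub_dcomp_act (A A' B B' C C' D D' : finType)
    (f : A -> A') (g : B -> B') (h : C -> C') (k : D -> D')
    (x : sub_grmod (option A) B) (y : sub_grmod C (option D)) :
  bijective f -> bijective g -> bijective h -> bijective k ->
  sub_dcomp (sub_dact (omap f) g x) (sub_dact h (omap k) y)
  = sub_dact (smap f h) (smap g k) (sub_dcomp x y).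
Proof.
move=> fB gB hB kB; apply: sub_val_inj => /=.
rewrite !sub_dactE ?dcomp_act //; by [apply: omap_bij | apply: smap_bij].
Qed.

Lemma sub_dunit_hom : hom 0 sub_dunit.
Proof. apply/sub_homP; exact: dunit_hom. Qed.

Lemma sub_dcomp_unitl (C D : finType) (y : sub_grmod C (option D)) :
  sub_dcomp (sub_dact (unlift (ord0 : 'I_1)) id sub_dunit) y
  = sub_dact inr (oapp inr (inl ord0)) y.
Proof.
apply: sub_val_inj => /=; rewrite !sub_dactE ?dcomp_unitl //.
- exact: inr0_bij.
- exact: unitl_bij.
- exact: unlift_bij.
- exact: id_bij.
Qed.

Lemma sub_dcomp_unitr (A B : finType) (x : sub_grmod (option A) B) :
  sub_dcomp x (sub_dact id (unlift (ord0 : 'I_1)) sub_dunit)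
  = sub_dact (oapp inl (inr ord0)) inl x.
Proof.
apply: sub_val_inj => /=; rewrite !sub_dactE ?dcomp_unitr //.
- exact: unitr_bij.
- exact: inl0_bij.
- exact: id_bij.
- exact: unlift_bij.
Qed.

Lemma sub_dcomp_seq (A B C D E F : finType) (x : sub_grmod (option A) B)
    (y : sub_grmod (option C) (option D)) (z : sub_grmod E (option F)) :
  sub_dact (@sassoc _ _ _) (@sassoc _ _ _)
    (sub_dcomp (sub_dact (@opull_r _ _) id (sub_dcomp x y)) z)
  = sub_dcomp x (sub_dact id (@opull_l _ _) (sub_dcomp y z)).
Proof.
apply: sub_val_inj => /=; rewrite sub_dactE /=; try exact: sassoc_bij.
rewrite !sub_dactE; try by [exact: id_bij | exact: opull_r_bij | exact: opull_l_bij].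
exact: dcomp_seq.
Qed.

Lemma sub_dcomp_parout (A B C D E F : finType) (x : sub_grmod (option (option A)) B)
    (y : sub_grmod C (option D)) (z : sub_grmod E (option F)) d e :
  hom d y -> hom e z ->
  sub_dcomp (sub_dact (@opull_l _ _) id (sub_dcomp x y)) z
  = ksign K (d * e) *: sub_dact (@sswap_r _ _ _) (@sswap_r _ _ _)
      (sub_dcomp (sub_dact (@opull_l _ _) id
         (sub_dcomp (sub_dact (@oswap _) id x) z)) y).
Proof.
move=> /sub_homP dy /sub_homP ez; apply: sub_val_inj => /=.
rewrite !sub_dactE /=;
  try by [exact: id_bij | exact: opull_l_bij | exact: sswap_r_bij].
rewrite !sub_dactE /=; try by [exact: id_bij | exact: opull_l_bij | exact: oswap_bij].
rewrite !sub_dactE /=; try by [exact: id_bij | exact: oswap_bij].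
exact: dcomp_parout.
Qed.

Lemma sub_dcomp_parin (A B C D E F : finType) (x : sub_grmod (option A) B)
    (y : sub_grmod (option C) D) (z : sub_grmod E (option (option F))) d e :
  hom d x -> hom e y ->
  sub_dcomp x (sub_dact id (@opull_r _ _) (sub_dcomp y z))
  = ksign K (d * e) *: sub_dact (@sswap_l _ _ _) (@sswap_l _ _ _)
      (sub_dcomp y (sub_dact id (@opull_r _ _)
         (sub_dcomp x (sub_dact id (@oswap _) z)))).
Proof.
move=> /sub_homP dx /sub_homP ey; apply: sub_val_inj => /=.
rewrite !sub_dactE /=;
  try by [exact: id_bij | exact: opull_r_bij | exact: sswap_l_bij].
rewrite !sub_dactE /=; try by [exact: id_bij | exact: opull_r_bij | exact: oswap_bij].
rewrite !sub_dactE /=; try by [exact: id_bij | exact: oswap_bij].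
exact: dcomp_parin.
Qed.

Definition sub_dioperad : dioperad K :=
  @Dioperad K sub_grmod sub_dact sub_dcomp sub_dunit sub_dact_linear sub_dact_hom
    sub_dact_id sub_dact_comp sub_dcomp_linearl sub_dcomp_linearr sub_dcomp_hom
    sub_dcomp_act sub_dunit_hom sub_dcomp_unitl sub_dcomp_unitr sub_dcomp_seq
    sub_dcomp_parout sub_dcomp_parin.

Lemma sub_val_dmorphism :
  @is_dmorphism K sub_dioperad Q (fun A B => @sub_val A B).
Proof.
split=> //.
- by move=> A B d x /sub_homP.
- by move=> A A' B B' g h x gB hB; apply: sub_dactE.
Qed.

End SubDioperad.

Lemma comp_dmorphism (K : fieldType) (P Q D : dioperad K)
    (f : forall A B : finType, P A B -> Q A B)
    (g : forall A B : finType, Q A B -> D A B) :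
  is_dmorphism f -> is_dmorphism g -> is_dmorphism (fun A B x => g A B (f A B x)).
Proof.
move=> fM gM; split.
- by move=> A B a x y; rewrite (dmor_linear fM) (dmor_linear gM).
- by move=> A B d x /(dmor_hom fM) /(dmor_hom gM).
- by move=> A A' B B' h k x hB kB; rewrite (dmor_act fM) // (dmor_act gM).
- by move=> A B C D' x y; rewrite (dmor_comp fM) (dmor_comp gM).
- by rewrite (dmor_unit fM) (dmor_unit gM).
Qed.

(** The subdioperad cut out by [V] contains the generators and inherits the relations, so [Q] maps
    to it. Followed by the inclusion, this map fixes the generators, hence is the identity, and
    every element lies in [V]. *)
Lemma presented_ind (K : fieldType) (q : quadratic K) (Q : dioperad K)
    (l : Q 'I_1 'I_2) (del : 'I_2 -> Q 'I_2 'I_1) (V : closed_family Q) :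
  is_presented q l del -> V _ _ l -> (forall x, V _ _ (del x)) ->
  forall (A B : finType) (x : Q A B), V A B x.
Proof.
move=> [modQ uQ] Vl Vd A B x.
pose D := sub_dioperad V.
have vM := sub_val_dmorphism V.
pose l' : D 'I_1 'I_2 := mk_sub Vl.
pose del' x : D 'I_2 'I_1 := mk_sub (Vd x).
have modD : is_model q l' del'.
  have Z (A' B' : finType) I (r : seq I) (c : I -> K) (F : I -> D A' B') :
      \sum_(i <- r) c i *: sub_val (F i) = 0 -> \sum_(i <- r) c i *: F i = 0.
    move=> s0; apply: sub_val_inj; rewrite -[RHS]s0 [LHS](dmor_sum vM).
    by apply: eq_bigr => i _; rewrite (dmorZ vM).
  case: modQ => dl dd syml skewd r13 r31 r22; split.
  - exact/sub_homP.
  - by move=> y; apply/sub_homP/dd.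
  - by apply: sub_val_inj; rewrite [LHS](dmor_act vM) //; [exact: id_bij|exact: rev_ord_bij].
  - move=> y; apply: sub_val_inj; rewrite [LHS](dmor_act vM) ?skewd //.
      exact: rev_ord_bij.
    exact: id_bij.
  - move=> u /r13 H; apply: Z; rewrite -[RHS]H; apply: eq_bigr => w _.
    by congr (_ *: _); apply: (dmor_mono_ll vM).
  - move=> u /r31 H; apply: Z; rewrite -[RHS]H; apply: eq_bigr => w _.
    by congr (_ *: _); apply: (dmor_mono_dd vM).
  - move=> u /r22 H; apply: Z; rewrite -[RHS]H; apply: eq_bigr => w _.
    by congr (_ *: _); apply: (dmor_mono_ld vM).
have [f [fM [fl fd]] _] := uQ D l' del' modD.
(* [g] is the unique endomorphism fixing the generators; the composite through [D] and the identity
   are both compared with it. *)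
have [g _ gU] := uQ Q l del modQ.
have fE : sub_val (f A B x) = g A B x.
  apply: (gU (fun A B x => sub_val (f A B x))).
  - exact: comp_dmorphism fM vM.
  - by rewrite fl.
  - by move=> y; rewrite fd.
have idE : x = g A B x by apply: (gU (fun A B x => x)) => //; split.
by rewrite idE -fE; apply: sub_opP.
Qed.

(** * Operations up to sign and relabelling *)

Lemma bij_card (A B : finType) : #|A| = #|B| -> exists f : A -> B, bijective f.
Proof.
move=> e; exists (fun a => enum_val (cast_ord e (enum_rank a))).
exists (fun b => enum_val (cast_ord (esym e) (enum_rank b))) => x;
  by rewrite enum_valK ?cast_ordK ?cast_ordKV enum_rankK.
Qed.

Lemma bij_card_at (A B : finType) (a : A) (b : B) : #|A| = #|B| ->
  exists2 f : A -> B, bijective f & f a = b.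
Proof.
move=> /bij_card[f fB]; exists (tperm (f a) b \o f); last by rewrite /= tpermL.
apply: bij_comp => //; exact: (Bijective (permK _) (permKV _)).
Qed.

Lemma perm_fun_bij (T : finType) (s : {perm T}) : bijective s.
Proof. exact: (Bijective (permK _) (permKV _)). Qed.

Lemma bij_perm (T : finType) (f : T -> T) : bijective f ->
  exists s : {perm T}, f = s.
Proof.
by move=> /bij_inj fI; exists (perm fI); apply: funext => x; rewrite permE.
Qed.

Ltac bij := lazymatch goal with
  | |- bijective (omap _) => apply: omap_bij; bij
  | |- bijective (smap _ _) => apply: smap_bij; bij
  | |- bijective (_ \o _) => apply: bij_comp; bij
  | |- bijective _ => first [assumption | exact: id_bij | exact: perm_fun_bij
     | exact: opull_r_bij | exact: opull_l_bij | exact: sassoc_bij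
     | exact: unlift_bij | exact: rev_ord_bij]
  end.

Section Sim.
Variables (K : fieldType) (Q : dioperad K).

Definition sim (A B : finType) (x y : Q A B) := x = y \/ x = - y.

Lemma sim_refl (A B : finType) (x : Q A B) : sim x x.
Proof. by left. Qed.

Lemma sim_sym (A B : finType) (x y : Q A B) : sim x y -> sim y x.
Proof. by case=> ->; [left|right; rewrite opprK]. Qed.

Lemma sim_trans (A B : finType) (y x z : Q A B) : sim x y -> sim y z -> sim x z.
Proof.
by case=> -> [->|->]; rewrite ?opprK; [left|right|right|left].
Qed.

Lemma dact0 (A A' B B' : finType) (f : A -> A') (g : B -> B') :
  bijective f -> bijective g -> dact f g (0 : Q A B) = 0.
Proof.
move=> fB gB; have := @dact_linear K Q _ _ _ _ f g fB gB (-1) 0 0.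
by rewrite scaler0 addr0 scaleN1r addNr.
Qed.

Lemma dcomp0l (A B C D : finType) (y : Q C (option D)) :
  dcomp (0 : Q (option A) B) y = 0.
Proof.
have := @dcomp_linearl K Q A B C D y (-1) 0 0.
by rewrite scaler0 addr0 scaleN1r addNr.
Qed.

Lemma dcomp0r (A B C D : finType) (x : Q (option A) B) :
  dcomp x (0 : Q C (option D)) = 0.
Proof.
have := @dcomp_linearr K Q A B C D x (-1) 0 0.
by rewrite scaler0 addr0 scaleN1r addNr.
Qed.

Lemma dactN (A A' B B' : finType) (f : A -> A') (g : B -> B') (x : Q A B) :
  bijective f -> bijective g -> dact f g (- x) = - dact f g x.
Proof.
move=> fB gB; rewrite -scaleN1r -[_ *: x]addr0 dact_linear //.
by rewrite dact0 // addr0 scaleN1r.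
Qed.

Lemma dcompNl (A B C D : finType) (x : Q (option A) B) (y : Q C (option D)) :
  dcomp (- x) y = - dcomp x y.
Proof.
have := @dcomp_linearl K Q A B C D y (-1) x 0.
by rewrite addr0 scaleN1r dcomp0l addr0 scaleN1r.
Qed.

Lemma dcompNr (A B C D : finType) (x : Q (option A) B) (y : Q C (option D)) :
  dcomp x (- y) = - dcomp x y.
Proof.
have := @dcomp_linearr K Q A B C D x (-1) y 0.
by rewrite addr0 scaleN1r dcomp0r addr0 scaleN1r.
Qed.

Lemma sim_act (A A' B B' : finType) (f : A -> A') (g : B -> B') (x y : Q A B) :
  bijective f -> bijective g -> sim x y -> sim (dact f g x) (dact f g y).
Proof. by move=> fB gB [->|->]; [left|right; rewrite dactN]. Qed.

Lemma sim_comp (A B C D : finType) (x x' : Q (option A) B) (y y' : Q C (option D)) :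
  sim x x' -> sim y y' -> sim (dcomp x y) (dcomp x' y').
Proof.
by case=> -> [->|->]; rewrite ?dcompNl ?dcompNr ?opprK;
  [left|right|right|left].
Qed.

(** The label sets may differ, so a composite on sums and options can be compared directly with a
    comb on ordinals, without naming the relabelling. *)
Definition req (A B A' B' : finType) (x : Q A B) (y : Q A' B') :=
  exists f : A' -> A, exists g : B' -> B,
    [/\ bijective f, bijective g & sim x (dact f g y)].

Lemma req_act (A A' B B' : finType) (f : A' -> A) (g : B' -> B) (x : Q A' B') :
  bijective f -> bijective g -> req (dact f g x) x.
Proof. by move=> fB gB; exists f, g; split=> //; left. Qed.

Lemma req_sim (A B : finType) (x y : Q A B) : sim x y -> req x y.
Proof. by exists id, id; split; rewrite ?dact_id //; apply: id_bij. Qed.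

Lemma req_refl (A B : finType) (x : Q A B) : req x x.
Proof. exact/req_sim/sim_refl. Qed.

Lemma req_sym (A B A' B' : finType) (x : Q A B) (y : Q A' B') : req x y -> req y x.
Proof.
move=> [f [g [fB gB xy]]]; have [f' fK f'K] := fB; have [g' gK g'K] := gB.
have f'B : bijective f' by exists f.
have g'B : bijective g' by exists g.
exists f', g'; split=> //.
rewrite -[y]dact_id (_ : id = f' \o f); last by apply: funext => u /=.
rewrite [in X in sim X _](_ : @id B' = g' \o g); last by apply: funext => u /=.
rewrite dact_comp //; apply: sim_act => //; exact: sim_sym.
Qed.

Lemma req_trans (A B A' B' A'' B'' : finType) (y : Q A' B') (x : Q A B)
  (z : Q A'' B'') : req x y -> req y z -> req x z.
Proof.
move=> [f [g [fB gB xy]]] [f' [g' [f'B g'B yz]]].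
exists (f \o f'), (g \o g'); split; try exact: bij_comp.
rewrite dact_comp //; apply: sim_trans xy _; exact: sim_act.
Qed.

Lemma req_card (A B A' B' : finType) (x : Q A B) (y : Q A' B') : req x y ->
  #|A| = #|A'| /\ #|B| = #|B'|.
Proof. by move=> [f [g [/bij_eq_card -> /bij_eq_card ->]]]. Qed.

Definition tfix_out (A B : finType) (u v : A) (x : Q A B) :=
  sim (dact (tperm u v) id x) x.
Definition tfix_in (A B : finType) (u v : B) (x : Q A B) :=
  sim (dact id (tperm u v) x) x.

Lemma tfix_out_act (A B A' B' : finType) (u v : A) (f : A -> A') (g : B -> B')
    (x y : _) : bijective f -> bijective g -> sim y (dact f g x) ->
  tfix_out u v x -> tfix_out (f u) (f v) y.
Proof.
move=> fB gB yx H; rewrite /tfix_out.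
apply: sim_trans (sim_act _ _ yx) _; try bij.
rewrite -dact_comp; try bij.
rewrite (_ : tperm (f u) (f v) \o f = f \o tperm u v); last first.
  by apply: funext => w /=; rewrite (inj_tperm _ _ _ (bij_inj fB)).
rewrite (_ : id \o g = g \o id) // dact_comp; try bij.
apply: sim_trans (sim_act fB gB H) _; exact: sim_sym.
Qed.

Lemma tfix_in_act (A B A' B' : finType) (u v : B) (f : A -> A') (g : B -> B')
    (x y : _) : bijective f -> bijective g -> sim y (dact f g x) ->
  tfix_in u v x -> tfix_in (g u) (g v) y.
Proof.
move=> fB gB yx H; rewrite /tfix_in.
apply: sim_trans (sim_act _ _ yx) _; try bij.
rewrite -dact_comp; try bij.
rewrite (_ : tperm (g u) (g v) \o g = g \o tperm u v); last first.
  by apply: funext => w /=; rewrite (inj_tperm _ _ _ (bij_inj gB)).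
rewrite (_ : id \o f = f \o id) // dact_comp; try bij.
apply: sim_trans (sim_act fB gB H) _; exact: sim_sym.
Qed.

(** Transpositions generate all permutations, and they localise the question for a composite: each
    moves legs of one factor only or exchanges legs of both. *)
Definition symel (A B : finType) (x : Q A B) :=
  (forall u v, tfix_out u v x) /\ (forall u v, tfix_in u v x).

Lemma symel_req (A B A' B' : finType) (x : Q A B) (y : Q A' B') :
  req x y -> symel y -> symel x.
Proof.
move=> [f [g [fB gB xy]]] [yo yi]; have [f' fK f'K] := fB; have [g' gK g'K] := gB.
split=> u v.
  by rewrite -[u]f'K -[v]f'K; apply: tfix_out_act fB gB xy _.
by rewrite -[u]g'K -[v]g'K; apply: tfix_in_act fB gB xy _.
Qed.

Lemma symel_perm (A B : finType) (x : Q A B) (s : {perm A}) (t : {perm B}) :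
  symel x -> sim (dact s t x) x.
Proof.
move=> [xo xi].
have S : sim (dact s id x) x.
  have [ts -> _] := prod_tpermP s; elim: ts => [|p ts IH].
    rewrite big_nil; left; rewrite -[RHS]dact_id; congr dact.
    by apply: funext => u; rewrite perm1.
  rewrite big_cons; set q := (\prod_(_ <- _) _)%g in IH *.
  rewrite (_ : (tperm p.1 p.2 * q)%g = q \o tperm p.1 p.2 :> (A -> A)); last first.
    by apply: funext => u; rewrite permM.
  rewrite (_ : @id B = id \o id) // dact_comp; try bij.
  apply: sim_trans IH; apply: sim_act; try bij; exact: xo.
apply: sim_trans S.
have [ts -> _] := prod_tpermP t; elim: ts => [|p ts IH].
  rewrite big_nil; left; congr dact; by apply: funext => u; rewrite perm1.
rewrite big_cons; set q := (\prod_(_ <- _) _)%g in IH *.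
rewrite (_ : (tperm p.1 p.2 * q)%g = q \o tperm p.1 p.2 :> (B -> B)); last first.
  by apply: funext => u; rewrite permM.
rewrite [X in dact X](_ : _ = s \o id) // dact_comp; try bij.
apply: sim_trans IH; apply: sim_act; try bij; exact: xi.
Qed.

Lemma symel_act (A B A' B' : finType) (x : Q A B) (f f' : A -> A') (g g' : B -> B') :
  symel x -> bijective f -> bijective g -> bijective f' -> bijective g' ->
  sim (dact f g x) (dact f' g' x).
Proof.
move=> xS fB gB f'B g'B; have [f1 fK f1K] := f'B; have [g1 gK g1K] := g'B.
have f1B : bijective f1 by exists f'.
have g1B : bijective g1 by exists g'.
have [s sE] := bij_perm (bij_comp f1B fB); have [t tE] := bij_perm (bij_comp g1B gB).
rewrite (_ : f = f' \o s); last by rewrite -sE; apply: funext => u /=.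
rewrite (_ : g = g' \o t); last by rewrite -tE; apply: funext => u /=.
rewrite dact_comp; try bij; apply: sim_act => //; exact: symel_perm.
Qed.

Lemma symel_rel (A B A' B' : finType) (x : Q A B) (y : Q A' B') (f : A' -> A)
    (g : B' -> B) : symel y -> req x y -> bijective f -> bijective g ->
  sim x (dact f g y).
Proof.
move=> yS [f' [g' [f'B g'B xy]]] fB gB; apply: sim_trans xy _; exact: symel_act.
Qed.

(** The relabellings given by [req] need not fix the plugged legs [None]. By symmetry of [x'] and
    [y'] they can be replaced by ones of the form [omap _], through which composition is
    equivariant. *)
Lemma dcomp_req (A B C D A' B' C' D' : finType)
    (x : Q (option A) B) (y : Q C (option D))
    (x' : Q (option A') B') (y' : Q C' (option D')) :
  req x x' -> req y y' -> symel x' -> symel y' -> req (dcomp x y) (dcomp x' y').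
Proof.
move=> xx yy xS yS; have [cA cB] := req_card xx; have [cC cD] := req_card yy.
move: cA cD; rewrite !card_option => -[cA] [cD].
have [a aB] := bij_card (esym cA); have [b bB] := bij_card (esym cB).
have [c cB'] := bij_card (esym cC); have [d dB] := bij_card (esym cD).
exists (smap a c), (smap b d); split; try bij.
rewrite -dcomp_act //; apply: sim_comp; apply: symel_rel => //; bij.
Qed.

Lemma seq_req (A B C D E F : finType) (x : Q (option A) B)
      (y : Q (option C) (option D)) (z : Q E (option F)) :
  req (dcomp (dact (@opull_r _ _) id (dcomp x y)) z)
      (dcomp x (dact id (@opull_l _ _) (dcomp y z))).
Proof.
rewrite -dcomp_seq; apply: req_sym; apply: req_act; bij.
Qed.

(** Transpositions inside one factor come from permutations of that factor fixing its plugged leg;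
    only those across the internal edge need a separate argument. *)
Lemma symel_dcomp (A B C D : finType) (x : Q (option A) B) (y : Q C (option D)) :
  symel x -> symel y ->
  (forall a c, tfix_out (inl a) (inr c) (dcomp x y)) ->
  (forall b d, tfix_in (inl b) (inr d) (dcomp x y)) -> symel (dcomp x y).
Proof.
move=> xS yS Ho Hi.
have O (f : {perm A}) (g : {perm B}) (h : {perm C}) (k : {perm D}) :
    sim (dact (smap f h) (smap g k) (dcomp x y)) (dcomp x y).
  rewrite -dcomp_act; try bij; apply: sim_comp.
    by rewrite -[X in sim _ X]dact_id; apply: symel_act => //; bij.
  by rewrite -[X in sim _ X]dact_id; apply: symel_act => //; bij.
have I1 (T : finType) : @id T = (1%g : {perm T}) by apply: funext => u; rewrite perm1.
have I2 (T T' : finType) : @id (T + T') = smap (1%g : {perm T}) (1%g : {perm T'}).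
  by apply: funext => -[] u; rewrite /= perm1.
have Tl (T T' : finType) (u v : T) :
    tperm (inl u) (inl v) = smap (tperm u v) (1%g : {perm T'}) :> (_ -> _).
  apply: funext => -[w|w] /=; last by rewrite perm1 tpermD.
  by rewrite -(inj_tperm _ _ _ (f := inl)) // => ? ? [].
have Tr (T T' : finType) (u v : T') :
    tperm (inr u) (inr v) = smap (1%g : {perm T}) (tperm u v) :> (_ -> _).
  apply: funext => -[w|w] /=; first by rewrite perm1 tpermD.
  by rewrite -(inj_tperm _ _ _ (f := inr)) // => ? ? [].
split=> [[u|u] [v|v]|[u|u] [v|v]].
- by rewrite /tfix_out Tl I2.
- exact: Ho.
- by rewrite /tfix_out tpermC; exact: Ho.
- by rewrite /tfix_out Tr I2.
- by rewrite /tfix_in Tl I2.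
- exact: Hi.
- by rewrite /tfix_in tpermC; exact: Hi.
- by rewrite /tfix_in Tr I2.
Qed.

(* After reassociation the two transposed legs lie on the lower factor
   [dcomp y0 y]. *)
Lemma tfix_seq (A B C D A' B' C0 D0 : finType) (x : Q (option A) B)
    (y : Q C (option D)) (x' : Q (option A') B') (y0 : Q (option C0) (option D0)) :
  symel x -> req x (dact (@opull_r _ _) id (dcomp x' y0)) -> symel (dcomp y0 y) ->
  (forall (c0 : C0) a c, tfix_out (inl a) (inr c) (dcomp x y)) /\
  (forall (d0 : D0) b d, tfix_in (inl b) (inr d) (dcomp x y)).
Proof.
move=> xS xE wS; set z := dact _ _ _ in xE.
have zS : symel z by apply: symel_req xS; apply: req_sym.
have [cA cB] := req_card xE; move: cA; rewrite !card_option => -[cA].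
have wS' : symel (dact id (@opull_l _ _) (dcomp y0 y)).
  by apply: symel_req wS; apply: req_act; bij.
have [sA sAK sAK'] := sassoc_bij A' C0 C.
have [sB sBK sBK'] := sassoc_bij B' D0 D.
(* Sequential associativity, read backwards through the inverses of [sassoc]. *)
have TE : dcomp z y = dact sA sB (dcomp x' (dact id (@opull_l _ _) (dcomp y0 y))).
  rewrite -dcomp_seq -dact_comp; try bij; first last.
  - by exists (@sassoc _ _ _).
  - by exists (@sassoc _ _ _).
  rewrite -[LHS]dact_id; congr dact; by apply: funext => u /=.
have sAB : bijective sA by exists (@sassoc _ _ _).
have sBB : bijective sB by exists (@sassoc _ _ _).
have X f g : bijective f -> bijective g ->
    sim (dcomp x y) (dact (smap f id) (smap g id) (dcomp z y)).
  move=> fB gB; rewrite -dcomp_act; try bij.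
  apply: sim_comp; first by apply: symel_rel => //; bij.
  rewrite (_ : omap id = id) ?dact_id; [exact: sim_refl|by apply: funext => -[]].
(* [c0] and [d0] are free legs of [y0]. By symmetry of [x], its relabelling from [z] can be chosen
   to carry such a leg to the leg being transposed. *)
split=> [c0 a c|d0 b d].
  have [f fB fa] := bij_card_at (inr c0 : A' + C0) a (esym cA).
  have [g gB] := bij_card (esym cB).
  rewrite -fa (_ : inl (f _) = smap f id (inl (inr c0))) //.
  rewrite (_ : inr c = smap f id (inr c)) //.
  apply: tfix_out_act (X f g fB gB) _; try bij.
  rewrite (_ : inl (inr c0) = sA (inr (inl c0))); last by rewrite -[LHS]sAK.
  rewrite (_ : inr c = sA (inr (inr c))); last by rewrite -[LHS]sAK.
  apply: tfix_out_act (or_introl TE) _ => //.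
  rewrite /tfix_out (_ : tperm _ _ = smap id (tperm (inl c0) (inr c)) :> (_ -> _)).
    rewrite (_ : id = smap id id); last by apply: funext => -[].
    rewrite -dcomp_act; try bij.
    apply: sim_comp; first rewrite (_ : omap id = id) ?dact_id.
    - exact: sim_refl.
    - by apply: funext => -[].
    rewrite (_ : omap id = id); last by apply: funext => -[].
    exact: wS'.1.
  apply: funext => -[w|w] /=; first by rewrite tpermD.
  by rewrite -(inj_tperm _ _ _ (f := inr)) // => ? ? [].
have [f fB] := bij_card (esym cA).
have [g gB ga] := bij_card_at (inr d0 : B' + D0) b (esym cB).
rewrite -ga (_ : inl (g _) = smap g id (inl (inr d0))) //.
rewrite (_ : inr d = smap g id (inr d)) //.
apply: tfix_in_act (X f g fB gB) _; try bij.
rewrite (_ : inl (inr d0) = sB (inr (inl d0))); last by rewrite -[LHS]sBK.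
rewrite (_ : inr d = sB (inr (inr d))); last by rewrite -[LHS]sBK.
apply: tfix_in_act (or_introl TE) _ => //.
rewrite /tfix_in (_ : tperm _ _ = smap id (tperm (inl d0) (inr d)) :> (_ -> _)).
  rewrite (_ : id = smap id id); last by apply: funext => -[].
  rewrite -dcomp_act; try bij.
  apply: sim_comp; first rewrite (_ : omap id = id) ?dact_id.
  - exact: sim_refl.
  - by apply: funext => -[].
  rewrite (_ : omap (tperm _ _) = tperm (Some (inl d0)) (Some (inr d))); first exact: wS'.2.
  apply: funext => -[w|] /=; last by rewrite tpermD.
  by rewrite -(inj_tperm _ _ _ (f := Some)) // => ? ? [].
apply: funext => -[w|w] /=; first by rewrite tpermD.
by rewrite -(inj_tperm _ _ _ (f := inr)) // => ? ? [].
Qed.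

End Sim.

(** * Combs *)

Lemma sum_delta (K : fieldType) (V : lmodType K) (I : finType) (w w' : I) (F : I -> V) :
  \sum_v ((v == w)%:R - (v == w')%:R) *: F v = F w - F w'.
Proof.
under eq_bigr do rewrite scalerBl.
rewrite sumrB (bigD1 w) //= (bigD1 (F := fun v => (v == w')%:R *: F v) w') //= !eqxx !scale1r.
by rewrite !big1 ?addr0 // => v /negbTE ->; rewrite scale0r.
Qed.

(** The difference of two basis vectors annihilates every relation with equal coefficients at [w]
    and [w']; so it is a relation of the dual, and there the two monomials coincide. *)
Lemma sum_delta_r (K : fieldType) (I : finType) (w w' : I) (c : I -> K) :
  c w = c w' -> \sum_v c v * [ffun u : I => (u == w)%:R - (u == w')%:R : K] v = 0.
Proof.
move=> e; have := @sum_delta K K^o I w w' c; rewrite e subrr => H; rewrite -[RHS]H.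
by apply: eq_bigr => v _; rewrite ffunE mulrC.
Qed.

Section NormalForm.
Variables (K : fieldType) (Q : dioperad K).
Variables (l : Q 'I_1 'I_2) (del : 'I_2 -> Q 'I_2 'I_1).
Hypothesis modQ : is_model (koszul_dual (LieBi K)) l del.

Lemma ll_eq w w' : mono_ll l w = mono_ll l w'.
Proof.
apply/eqP; rewrite -subr_eq0 -(sum_delta _ _ (mono_ll l)); apply/eqP.
have := mod_13 modQ (u := [ffun u => (u == w)%:R - (u == w')%:R]) _.
under eq_bigr do rewrite ffunE; apply=> r ->.
apply: (sum_delta_r (c := fun v => ksign K 1 * [ffun=> 1] v)).
by rewrite !ffunE.
Qed.

(** The coefficients of (b) and (c) are invariant under rotation of the labels and under exchange of
    the two kinds. *)
Lemma dd_eq x y x' y' w w' : (x, y) = (x', y') \/ (x, y) = (y', x') ->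
  mono_dd del (x, y, w) = mono_dd del (x', y', w').
Proof.
move=> xy; apply/eqP; rewrite -subr_eq0 -(sum_delta _ _ (mono_dd del)); apply/eqP.
have := mod_31 modQ
  (u := [ffun u => (u == (x, y, w))%:R - (u == (x', y', w'))%:R]) _.
under eq_bigr do rewrite ffunE; apply=> r H.
apply: (sum_delta_r (c := fun v => ksign K 0 * r v)).
by case: xy => -[-> ->]; case: H => [[z ->]|->]; rewrite !ffunE //= ?(eq_sym x') // andbC.
Qed.

(** In (d) these two monomials have opposite coefficients; the desuspension sign of the first one,
    whose upper vertex is the product of degree 1, makes them equal. *)
Lemma ld_eq x i : mono_ld l del (x, None) = mono_ld l del (x, Some (i, ord0)).
Proof.
apply/eqP; rewrite -subr_eq0 -(sum_delta _ _ (mono_ld l del)); apply/eqP.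
have := mod_22 modQ
  (u := [ffun u => (u == (x, None))%:R - (u == (x, Some (i, ord0)))%:R]) _.
under eq_bigr do rewrite ffunE; apply=> r [z ->].
apply: (sum_delta_r (c := fun v => ksign K (if v.2 is None then 1 else 0) * _ v)).
by rewrite !ffunE /=; case: ifP; rewrite ?mulr0 // /ksign /= expr1 expr0 mul1r mulr1.
Qed.

Lemma ord1_eq (u v : 'I_1) : u = v.
Proof. by rewrite [u]ord1 [v]ord1. Qed.

Lemma tperm_ord1 (u v : 'I_1) : tperm u v = id :> ('I_1 -> 'I_1).
Proof. by apply: funext => w; apply: ord1_eq. Qed.

Lemma tperm_ord2 (u v : 'I_2) : tperm u v = id :> ('I_2 -> 'I_2) \/
  tperm u v = @rev_ord 2 :> ('I_2 -> 'I_2).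
Proof.
have [->|uv] := eqVneq u v; [left|right]; apply: funext => w.
  by rewrite tperm1 perm1.
apply/val_inj; rewrite permE /=; move: u v w uv.
by case=> -[|[|?]] ? //; case=> -[|[|?]] ? //; case=> -[|[|?]].
Qed.

Lemma symel_l : symel l.
Proof.
split=> u v; first by rewrite /tfix_out tperm_ord1 dact_id; left.
rewrite /tfix_in; case: (tperm_ord2 u v) => ->; first by rewrite dact_id; left.
by rewrite (mod_syml modQ); left.
Qed.

Lemma symel_del x : symel (del x).
Proof.
split=> u v; last by rewrite /tfix_in tperm_ord1 dact_id; left.
rewrite /tfix_out; case: (tperm_ord2 u v) => ->; first by rewrite dact_id; left.
by rewrite (mod_skewd modQ); right.
Qed.

(** With the next two identities: a transposition of the third label with another one is the
    exchange of the first two followed by a rotation. *)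
Lemma cyc_rev_neq (c u : 'I_2) : u != c ->
  cyc ord0 u = cyc (cyc ord0 c.+1) (rev_ord u).
Proof.
by move: c u => -[[|[|?]] ? //] [[|[|?]] ? //] _; apply/val_inj.
Qed.

Lemma cyc_rev (c : 'I_2) : cyc ord0 2 = cyc (cyc ord0 c.+1) (rev_ord c).
Proof. by move: c => -[[|[|?]] ? //]; apply/val_inj. Qed.

Lemma cyc_shift (c : 'I_2) : cyc ord0 c = cyc (cyc ord0 c.+1) 2.
Proof. by move: c => -[[|[|?]] ? //]; apply/val_inj. Qed.

Lemma sim_cancel (A B A' B' : finType) (f : A -> A') (g : B -> B') (x y : Q A B) :
  bijective f -> bijective g -> sim (dact f g x) (dact f g y) -> sim x y.
Proof.
move=> fB gB; have [f' fK f'K] := fB; have [g' gK g'K] := gB.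
have f'B : bijective f' by exists f.
have g'B : bijective g' by exists g.
move/(sim_act f'B g'B); rewrite -!dact_comp //.
rewrite (_ : f' \o f = id); last by apply: funext => u /=.
by rewrite (_ : g' \o g = id) ?dact_id //; apply: funext => u /=.
Qed.

(** A transposition across the internal edge is an exchange at the lower vertex, absorbed by
    skew-symmetry, followed by a rotation, absorbed by [dd_eq]. *)
Lemma symel_del_del x y : symel (graft ord0 ord0 (del x) (del y)).
Proof.
apply: symel_dcomp => [||a c|b []//].
- by apply: symel_req (symel_del x); apply: req_act; bij.
- by apply: symel_req (symel_del y); apply: req_act; bij.
rewrite -[dcomp _ _]/(graft ord0 ord0 (del x) (del y)).
have f0B := mono_dd_out_bij ord0; have gB := mono_dd_in_bij.
apply: (sim_cancel f0B gB); rewrite -dact_comp; try bij.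
set T := graft _ _ _ _.
have E : dact (fun u : 'I_1 + 'I_2 =>
    match u with inl _ => cyc ord0 2 | inr b => cyc ord0 b end) (fun=> ord0) T
  = mono_dd del (x, y, ord0) by [].
(* Rotation by [c.+1] is the one that sends the third place to [c]. *)
rewrite E (dd_eq (x' := x) (y' := y) _ (cyc ord0 c.+1)); last by left.
rewrite /mono_dd /=; set f0 := (X in X \o _); set fw := (X in sim _ (dact X _ _)).
rewrite (_ : f0 \o tperm (inl a) (inr c) = fw \o smap id (@rev_ord 2)); last first.
  apply: funext => -[u|u]; rewrite /= /f0 /fw.
    by rewrite [u](ord1_eq _ a) tpermL cyc_shift.
  case: tpermP => [//|[->]|_ uc]; first exact: cyc_rev.
  by apply: cyc_rev_neq; apply/eqP => e; case: uc; rewrite e.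
rewrite dact_comp; try bij; last exact: mono_dd_out_bij.
apply: sim_act => //; first exact: mono_dd_out_bij.
rewrite (_ : id = smap (@id 'I_1) (@id 'I_0)); last by apply: funext => -[].
rewrite /T /graft -dcomp_act; try bij; apply: sim_comp.
  rewrite (_ : omap id = id) ?dact_id; first exact: sim_refl.
  by apply: funext => -[].
rewrite (_ : omap id = id); last by apply: funext => -[].
rewrite -dact_comp; try bij.
by apply: symel_act; try bij; exact: symel_del.
Qed.

Lemma symel_l_l : symel (graft ord0 ord0 l l).
Proof.
apply: symel_dcomp => [||[] //|b d].
- by apply: symel_req symel_l; apply: req_act; bij.
- by apply: symel_req symel_l; apply: req_act; bij.
rewrite -[dcomp _ _]/(graft ord0 ord0 l l).
have g0B := mono_ll_in_bij ord0; have fB := mono_ll_out_bij.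
apply: (sim_cancel fB g0B); rewrite -dact_comp; try bij.
set T := graft _ _ _ _.
have E : dact (fun=> ord0) (fun u : 'I_2 + 'I_1 =>
    match u with inl a => cyc ord0 a | inr _ => cyc ord0 2 end) T
  = mono_ll l ord0 by [].
rewrite E (ll_eq _ (cyc ord0 b.+1)).
rewrite /mono_ll /=; set g0 := (X in X \o tperm _ _).
set gw := (X in sim _ (dact _ X _)).
rewrite (_ : g0 \o tperm (inl b) (inr d) = gw \o smap (@rev_ord 2) id); last first.
  apply: funext => -[u|u]; rewrite /= /g0 /gw; last first.
    by rewrite [u](ord1_eq _ d) tpermR cyc_shift.
  case: tpermP => [[->]|//|uc _]; first exact: cyc_rev.
  by apply: cyc_rev_neq; apply/eqP => e; case: uc; rewrite e.
rewrite dact_comp; try bij; last exact: mono_ll_in_bij.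
apply: sim_act => //; first exact: mono_ll_in_bij.
rewrite (_ : id = smap (@id 'I_0) (@id 'I_1)); last by apply: funext => -[].
have oid (A : Type) : omap (@id A) = id by apply: funext => -[].
rewrite /T /graft -dcomp_act; try bij; rewrite !oid dact_id.
apply: sim_comp (sim_refl _); rewrite -dact_comp; try bij.
by apply: symel_act; try bij; exact: symel_l.
Qed.

(** The only output of the product and the only input of the cooperation are plugged, so no
    transposition crosses the internal edge. *)
Lemma symel_l_del x : symel (graft ord0 ord0 l (del x)).
Proof.
apply: symel_dcomp => [||[] //|b [] //].
- by apply: symel_req symel_l; apply: req_act; bij.
- by apply: symel_req (symel_del x); apply: req_act; bij.
Qed.

Lemma req_ll (A B C D : finType) (x : Q (option A) B) (y : Q C (option D)) :
  req x l -> req y l -> req (dcomp x y) (graft ord0 ord0 l l).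
Proof.
move=> xl yl; apply: dcomp_req; do 1?[apply: symel_req symel_l; apply: req_act; bij].
- by apply: req_trans xl (req_sym _); apply: req_act; bij.
- by apply: req_trans yl (req_sym _); apply: req_act; bij.
Qed.

Lemma req_dd (A B C D : finType) (x : Q (option A) B) (y : Q C (option D)) i j :
  req x (del i) -> req y (del j) -> req (dcomp x y) (graft ord0 ord0 (del i) (del j)).
Proof.
move=> xl yl; apply: dcomp_req;
  do 1?[apply: symel_req (symel_del _); apply: req_act; bij].
- by apply: req_trans xl (req_sym _); apply: req_act; bij.
- by apply: req_trans yl (req_sym _); apply: req_act; bij.
Qed.

Lemma req_dd_swap i j :
  req (graft ord0 ord0 (del i) (del j)) (graft ord0 ord0 (del j) (del i)).
Proof.
have E : mono_dd del (i, j, ord0) = mono_dd del (j, i, ord0) by apply: dd_eq; right.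
have fB := mono_dd_out_bij ord0; have gB := mono_dd_in_bij.
apply: req_trans (req_sym (req_act _ fB gB)) _.
by rewrite -[dact _ _ _]/(mono_dd del (i, j, ord0)) E; apply: req_act.
Qed.

(** The dual of (d): a product below a cooperation may be moved above it. *)
Lemma req_ld (A B C D A' B' C' D' : finType) (x : Q (option A) B) (y : Q C (option D))
    (x' : Q (option A') B') (y' : Q C' (option D')) i :
  req x (del i) -> req y l -> req x' l -> req y' (del i) ->
  req (dcomp x y) (dcomp x' y') /\ symel (dcomp x' y').
Proof.
move=> xi yl x'l y'i.
have R0 : req (dcomp x' y') (graft ord0 ord0 l (del i)).
  apply: dcomp_req.
  - by apply: req_trans x'l (req_sym _); apply: req_act; bij.
  - by apply: req_trans y'i (req_sym _); apply: req_act; bij.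
  - by apply: symel_req symel_l; apply: req_act; bij.
  - by apply: symel_req (symel_del _); apply: req_act; bij.
split; last exact: symel_req R0 (symel_l_del i).
apply: req_trans (req_sym R0).
have R1 : req (dcomp x y) (graft ord_max ord0 (del i) l).
  apply: dcomp_req.
  - by apply: req_trans xi (req_sym _); apply: req_act; bij.
  - by apply: req_trans yl (req_sym _); apply: req_act; bij.
  - by apply: symel_req (symel_del _); apply: req_act; bij.
  - by apply: symel_req symel_l; apply: req_act; bij.
apply: req_trans R1 _.
apply: req_trans (req_sym (req_act _ (mono_ld_bij ord0) (mono_ld_bij ord0))) _.
rewrite -[dact _ _ _]/(mono_ld l del (i, Some (ord0, ord0))) -ld_eq.
by apply: req_act; [exact: join0_bij | exact: joinr0_bij].
Qed.

Local Notation ip := (iter_prod l).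
Local Notation cb := (comb l del).
Definition kind (p t : nat) : 'I_2 := if (t < p)%N then ord0 else ord_max.

Lemma iter_step (A B C D : finType) (x : Q (option A) B) (y : Q C (option D)) n :
  symel (ip n) -> req x (ip n) -> req y l -> req (dcomp x y) (ip n.+1).
Proof.
move=> S xn yl; rewrite iter_prodS.
apply: req_trans (req_sym (req_act _ mono_ll_out_bij (iter_prod_in_bij n))).
apply: dcomp_req.
- by apply: req_trans xn (req_sym _); apply: req_act; bij.
- by apply: req_trans yl (req_sym _); apply: req_act; bij.
- by apply: symel_req S; apply: req_act; bij.
- by apply: symel_req symel_l; apply: req_act; bij.
Qed.

(** Symmetry of the shorter comb is a hypothesis because [symel_comb] uses this lemma inside its own
    induction. *)
Lemma comb_step (A B C D : finType) (x : Q (option A) B) (y : Q C (option D)) n p t :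
  symel (cb n p t) -> req x (cb n p t) -> req y (del (kind p t)) ->
  req (dcomp x y) (cb n p t.+1).
Proof.
move=> S xn yl; rewrite combS -/(kind p t).
apply: req_trans (req_sym (req_act _ (comb_out_bij t) (joinr0_bij _))).
apply: dcomp_req.
- by apply: req_trans xn (req_sym _); apply: req_act; bij.
- by apply: req_trans yl (req_sym _); apply: req_act; bij.
- by apply: symel_req S; apply: req_act; bij.
- by apply: symel_req (symel_del _); apply: req_act; bij.
Qed.

Lemma symel_unit : symel (dunit Q).
Proof. by split=> u v; [rewrite /tfix_out|rewrite /tfix_in]; rewrite tperm_ord1 dact_id; left. Qed.

Lemma req_unitl (A B C D : finType) (x : Q (option A) B) (y : Q C (option D)) :
  req x (dunit Q) -> symel y -> req (dcomp x y) y.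
Proof.
move=> xu yS.
have R := req_act (dunit Q) (unlift_bij (ord0 : 'I_1)) (@id_bij 'I_1).
apply: req_trans (dcomp_req (req_trans xu (req_sym R)) (req_refl y) _ yS) _.
  exact: symel_req R symel_unit.
by rewrite dcomp_unitl; apply: req_act; [exact: inr0_bij | exact: unitl_bij].
Qed.

Lemma req_unitr (A B C D : finType) (x : Q (option A) B) (y : Q C (option D)) :
  req y (dunit Q) -> symel x -> req (dcomp x y) x.
Proof.
move=> yu xS.
have R := req_act (dunit Q) (@id_bij 'I_1) (unlift_bij (ord0 : 'I_1)).
apply: req_trans (dcomp_req (req_refl x) (req_trans yu (req_sym R)) xS _) _.
  exact: symel_req R symel_unit.
by rewrite dcomp_unitr; apply: req_act; [exact: unitr_bij | exact: inl0_bij].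
Qed.

(** Beyond one product, a transposition across the last internal edge is moved by [tfix_seq] to the
    last two products, where [symel_l_l] applies. This splits off two vertices, hence the strong
    induction. *)
Lemma symel_iter_prod n : symel (ip n).
Proof.
elim: n {-2}n (leqnn n) => [|N IH] [|[|n]] // nN; try exact: symel_unit.
  rewrite iter_prodS.
  apply: symel_req (req_act _ mono_ll_out_bij (iter_prod_in_bij 0)) _.
  have lS : symel (dact id (unlift (ord0 : 'I_2)) l).
    by apply: symel_req symel_l; apply: req_act; bij.
  by apply: symel_req (req_unitl _ lS) lS; apply: req_act; bij.
rewrite iter_prodS.
apply: symel_req (req_act _ mono_ll_out_bij (iter_prod_in_bij n.+1)) _.
have xS : symel (dact (unlift (ord0 : 'I_1)) id (ip n.+1)).
  by apply: symel_req (IH n.+1 _) => //; apply: req_act; bij.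
have yS : symel (dact id (unlift (ord0 : 'I_2)) l).
  by apply: symel_req symel_l; apply: req_act; bij.
pose x' := dact (unlift (ord0 : 'I_1)) id (ip n).
pose y0 := dact (unlift (ord0 : 'I_1)) (unlift (ord0 : 'I_2)) l.
have [||_ H] := tfix_seq (y := dact id (unlift (ord0 : 'I_2)) l) (x' := x') (y0 := y0) xS.
- apply: req_trans (req_act _ _ _) _; try bij.
  apply: req_sym; apply: req_trans (req_act _ _ _) _; try bij.
  by apply: iter_step; [apply: IH; exact: ltnW | apply: req_act; bij | apply: req_act; bij].
- by apply: symel_req symel_l_l; apply: req_ll; apply: req_act; bij.
- by apply: symel_dcomp => //; [case | exact: H (ord0 : 'I_1)].
Qed.

Lemma symel_comb n p t : symel (cb n p t).
Proof.
elim: t {-2}t (leqnn t) => [|N IH] [|t] // tN; try exact: symel_iter_prod.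
rewrite combS; apply: symel_req (req_act _ (comb_out_bij t) (joinr0_bij _)) _.
have xS : symel (dact (unlift (ord0 : 'I_t.+1)) id (cb n p t)).
  by apply: symel_req (IH t _) => //; apply: req_act; bij.
apply: symel_dcomp => // [||b []//].
  by apply: symel_req (symel_del _); apply: req_act; bij.
(* For the first cooperation the upper factor is an iterated product, which has no output left
   besides the plugged one. *)
case: t tN xS => [|t] tN xS; first by case.
pose x' := dact (unlift (ord0 : 'I_t.+1)) id (cb n p t).
pose y0 := dact (unlift (ord0 : 'I_2)) (unlift (ord0 : 'I_1)) (del (kind p t)).
have [||H _] := tfix_seq
  (y := dact id (unlift (ord0 : 'I_1)) (del (kind p t.+1)))
  (x' := x') (y0 := y0) xS.
- apply: req_trans (req_act _ _ _) _; try bij.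
  apply: req_sym; apply: req_trans (req_act _ _ _) _; try bij.
  by apply: comb_step; [apply: IH; exact: ltnW | apply: req_act; bij | apply: req_act; bij].
- by apply: symel_req (symel_del_del _ _); apply: req_dd; apply: req_act; bij.
- exact: H (ord0 : 'I_1).
Qed.

Lemma comb_ext n p p' t : (forall t', (t' < t)%N -> (t' < p)%N = (t' < p')%N) ->
  cb n p t = cb n p' t.
Proof.
elim: t => // t IH H; rewrite !combS IH ?H // => t' t't.
by apply: H; apply: ltnW.
Qed.

(** A new cooperation of the first kind is exchanged with those of the second kind above it, one at
    a time, until it joins the first p. *)
Lemma comb_del_first (A B C D : finType) (x : Q (option A) B) (y : Q C (option D)) n p t :
  (p <= t)%N -> req x (cb n p t) -> req y (del ord0) ->
  req (dcomp x y) (cb n p.+1 t.+1).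
Proof.
elim: t A B C D x y => [|t IH] A B C D x y pt xn yd.
  by apply: comb_step => //; exact: symel_iter_prod.
have [pt'|pt'] := leqP p t; last first.
  (* All cooperations present are of the first kind, so the new one already stands in its place. *)
  have pE : p = t.+1 by apply/eqP; rewrite eqn_leq pt.
  apply: comb_step; first exact: symel_comb.
    rewrite (@comb_ext _ p.+1 p) // => t' t't.
    by rewrite pE t't (ltnW (t't : (t'.+1 < t.+2)%N)).
  by rewrite /kind pE ltnS leqnn.
pose x' := dact (unlift (ord0 : 'I_t.+1)) id (cb n p t).
pose y' k := dact (unlift (ord0 : 'I_2)) (unlift (ord0 : 'I_1)) (del k).
pose z k := dact id (unlift (ord0 : 'I_1)) (del k).
have xR : req x' (cb n p t) by apply: req_act; bij.
have yR k : req (y' k) (del k) by apply: req_act; bij.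
have zR k : req (z k) (del k) by apply: req_act; bij.
have zS k : symel (z k) by apply: symel_req (zR k) (symel_del k).
have dS i j : symel (dcomp (y' i) (z j)).
  by apply: symel_req (req_dd _ _) (symel_del_del i j).
have wR k : req (dact (@opull_r _ _) id (dcomp x' (y' k))) (dcomp x' (y' k)).
  by apply: req_act; bij.
have R1 : req (dact (@opull_r _ _) id (dcomp x' (y' ord_max))) (cb n p t.+1).
  apply: req_trans (wR _) (comb_step (symel_comb _ _ _) xR _).
  by rewrite /kind ltnNge pt'.
apply: req_trans (dcomp_req (req_trans xn (req_sym R1)) (req_trans yd (req_sym (zR _))) _ (zS _)) _.
  exact: symel_req R1 (symel_comb _ _ _).
apply: req_trans (seq_req _ _ _) _.
apply: (@req_trans _ _ _ _ _ _ _ _ (dcomp x' (dact id (@opull_l _ _) (dcomp (y' ord0) (z ord_max))))).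
  apply: dcomp_req (req_refl _) _ _ _.
  - apply: req_trans (req_act _ _ _) _; try bij.
    apply: req_sym; apply: req_trans (req_act _ _ _) _; try bij.
    apply: req_trans (req_dd (yR _) (zR _)) _.
    apply: req_trans (req_dd_swap _ _) _; apply: req_sym; exact: req_dd.
  - exact: symel_req xR (symel_comb _ _ _).
  - by apply: symel_req (dS ord0 ord_max); apply: req_act; bij.
apply: req_trans (req_sym (seq_req _ _ _)) _.
apply: comb_step; first exact: symel_comb.
  by apply: req_trans (wR _) _; apply: IH.
by rewrite /kind ltnS ltnNge pt'.
Qed.

Lemma comb_del (A B C D : finType) (x : Q (option A) B) (y : Q C (option D)) n p t k :
  req x (cb n p t) -> req y (del k) -> exists p', req (dcomp x y) (cb n p' t.+1).
Proof.
move=> xn yd; have [kE|kN] := eqVneq k (kind p t).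
  by exists p; apply: comb_step => //; [exact: symel_comb | rewrite -kE].
have [pt|tp] := leqP p t.
  exists p.+1; apply: comb_del_first => //.
  suff -> : ord0 = k by [].
  move: kN; rewrite /kind ltnNge pt /=.
  by case: k {yd} => [[|[|?]] ?] // _; apply/val_inj.
(* All t cooperations are of the first kind. Lowering p to t keeps this comb and makes the next
   cooperation one of the second kind. *)
exists t; apply: comb_step; first exact: symel_comb.
  by rewrite (@comb_ext _ t p) // => t' t't; rewrite t't (ltn_trans t't).
suff -> : kind t t = k by [].
rewrite /kind ltnn; move: kN; rewrite /kind tp.
by case: k {yd} => [[|[|?]] ?] // _; apply/val_inj.
Qed.

(** By [req_ld] the new product climbs past the cooperations until it reaches the iterated
    product. *)
Lemma comb_l (A B C D : finType) (x : Q (option A) B) (y : Q C (option D)) n p t :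
  req x (cb n p t) -> req y l -> req (dcomp x y) (cb n.+1 p t).
Proof.
elim: t A B C D x y => [|t IH] A B C D x y xn yl.
  exact: iter_step (symel_iter_prod n) xn yl.
pose x' := dact (unlift (ord0 : 'I_t.+1)) id (cb n p t).
pose y' := dact (unlift (ord0 : 'I_2)) (unlift (ord0 : 'I_1)) (del (kind p t)).
pose z := dact id (unlift (ord0 : 'I_2)) l.
pose y1 := dact (unlift (ord0 : 'I_1)) (unlift (ord0 : 'I_2)) l.
pose z1 := dact id (unlift (ord0 : 'I_1)) (del (kind p t)).
have xR : req x' (cb n p t) by apply: req_act; bij.
have yR : req y' (del (kind p t)) by apply: req_act; bij.
have zR : req z l by apply: req_act; bij.
have y1R : req y1 l by apply: req_act; bij.
have z1R : req z1 (del (kind p t)) by apply: req_act; bij.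
have R1 : req (dact (@opull_r _ _) id (dcomp x' y')) (cb n p t.+1).
  apply: req_trans (req_act _ _ _) _; try bij.
  exact: comb_step (symel_comb _ _ _) xR yR.
apply: req_trans (dcomp_req (req_trans xn (req_sym R1)) (req_trans yl (req_sym zR)) _ _) _.
- exact: symel_req R1 (symel_comb _ _ _).
- exact: symel_req zR symel_l.
apply: req_trans (seq_req _ _ _) _.
have [LR LS] := req_ld yR zR y1R z1R.
apply: (@req_trans _ _ _ _ _ _ _ _ (dcomp x' (dact id (@opull_l _ _) (dcomp y1 z1)))).
  apply: dcomp_req (req_refl _) _ _ _.
  - apply: req_trans (req_act _ _ _) _; try bij.
    apply: req_sym; apply: req_trans (req_act _ _ _) _; try bij.
    exact: req_sym.
  - exact: symel_req xR (symel_comb _ _ _).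
  - by apply: symel_req LS; apply: req_act; bij.
apply: req_trans (req_sym (seq_req _ _ _)) _.
apply: comb_step z1R; first exact: symel_comb.
by apply: req_trans (req_act _ _ _) _; try bij; apply: IH.
Qed.

(** The vertices of the lower comb are detached from its bottom and, after reassociation, attached
    one by one to the comb obtained from the rest, by [comb_del] or [comb_l]. *)
Lemma comb_comb (A B C D : finType) (x : Q (option A) B) (y : Q C (option D))
    n p t n' p' t' :
  req x (cb n p t) -> req y (cb n' p' t') ->
  exists n'' p'' t'', req (dcomp x y) (cb n'' p'' t'').
Proof.
elim: t' A B C D x y => [|t' IH] A B C D x y xn.
  elim: n' A B C D x y xn => [|n' IHn] A B C D x y xn yn.
    exists n, p, t; have xS := symel_req xn (symel_comb n p t).
    exact: req_trans (req_unitr yn xS) xn.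
  pose y0 := dact (unlift (ord0 : 'I_1)) (unlift (ord0 : 'I_n'.+1)) (ip n').
  pose z := dact id (unlift (ord0 : 'I_2)) l.
  have yR : req y0 (ip n') by apply: req_act; bij.
  have zR : req z l by apply: req_act; bij.
  have R1 : req (dact id (@opull_l _ _) (dcomp y0 z)) (ip n'.+1).
    apply: req_trans (req_act _ _ _) _; try bij.
    exact: iter_step (symel_iter_prod _) yR zR.
  have [n1 [p1 [t1 H]]] := IHn _ _ _ _ _ _ xn yR.
  exists n1.+1, p1, t1.
  apply: req_trans (dcomp_req (req_refl x) (req_trans yn (req_sym R1)) _ _) _.
  - exact: symel_req xn (symel_comb _ _ _).
  - exact: symel_req R1 (symel_iter_prod _).
  apply: req_trans (req_sym (seq_req _ _ _)) _.
  by apply: comb_l zR; apply: req_trans H; apply: req_act; bij.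
move=> yn.
pose y0 := dact (unlift (ord0 : 'I_t'.+1)) (unlift (ord0 : 'I_n'.+1)) (cb n' p' t').
pose z := dact id (unlift (ord0 : 'I_1)) (del (kind p' t')).
have yR : req y0 (cb n' p' t') by apply: req_act; bij.
have zR : req z (del (kind p' t')) by apply: req_act; bij.
have R1 : req (dact id (@opull_l _ _) (dcomp y0 z)) (cb n' p' t'.+1).
  apply: req_trans (req_act _ _ _) _; try bij.
  exact: comb_step (symel_comb _ _ _) yR zR.
have [n1 [p1 [t1 H]]] := IH _ _ _ _ _ _ xn yR.
have [p2 H2] : exists p2, req (dcomp (dact (@opull_r _ _) id (dcomp x y0)) z) (cb n1 p2 t1.+1).
  by apply: comb_del zR; apply: req_trans H; apply: req_act; bij.
exists n1, p2, t1.+1; apply: req_trans H2.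
apply: req_trans (req_sym (seq_req _ _ _)).
apply: dcomp_req (req_refl x) (req_trans yn (req_sym R1)) _ _.
- exact: symel_req xn (symel_comb _ _ _).
- exact: symel_req R1 (symel_comb _ _ _).
Qed.

Inductive comb_span (A B : finType) : Q A B -> Prop :=
  | span_zero : comb_span 0
  | span_add a x y n p t :
      req x (cb n p t) -> comb_span y -> comb_span (a *: x + y).

Lemma span_one (A B : finType) (x : Q A B) n p t : req x (cb n p t) -> comb_span x.
Proof.
move=> xn; rewrite -[x]scale1r -[_ *: _]addr0.
exact: span_add xn (span_zero A B).
Qed.

Lemma span_lin (A B : finType) a (x y : Q A B) :
  comb_span x -> comb_span y -> comb_span (a *: x + y).
Proof.
move=> xs ys; elim: xs => [|b x' x'' n p t xn _ IH]; first by rewrite scaler0 add0r.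
by rewrite scalerDr scalerA -addrA; apply: span_add xn IH.
Qed.

Lemma span_act (A A' B B' : finType) (f : A -> A') (g : B -> B') (x : Q A B) :
  bijective f -> bijective g -> comb_span x -> comb_span (dact f g x).
Proof.
move=> fB gB; elim=> [|a y z n p t yn _ IH]; first by rewrite dact0 //; apply: span_zero.
rewrite dact_linear //; apply: span_add IH.
by apply: req_trans yn; apply: req_act.
Qed.

Lemma span_comp (A B C D : finType) (x : Q (option A) B) (y : Q C (option D)) :
  comb_span x -> comb_span y -> comb_span (dcomp x y).
Proof.
move=> xs; elim=> [|b u v n' p' t' un _ IHy]; first by rewrite dcomp0r; apply: span_zero.
rewrite dcomp_linearr; apply: span_lin IHy.
elim: xs => [|a x1 x2 n p t x1n _ IHx]; first by rewrite dcomp0l; apply: span_zero.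
rewrite dcomp_linearl; apply: span_lin IHx.
by have [n1 [p1 [t1 /span_one]]] := comb_comb x1n un.
Qed.

Lemma hom0 (A B : finType) d : hom d (0 : Q A B).
Proof. by rewrite /hom linear0. Qed.

Lemma homP (A B : finType) d a (x y : Q A B) :
  hom d x -> hom d y -> hom d (a *: x + y).
Proof. by rewrite /hom linearP => -> ->. Qed.

Lemma hom_sim (A B : finType) d (x y : Q A B) : sim x y -> hom d y -> hom d x.
Proof. by case=> [->//|-> dy]; rewrite -[- y]addr0 -scaleN1r; apply: homP dy (hom0 _ _ _). Qed.

Lemma hom_proj (A B : finType) d e (x : Q A B) : hom e x ->
  gr_proj (Q A B) d x = if d == e then x else 0.
Proof. by move=> ex; rewrite -{1}ex gr_projK ex. Qed.

Lemma hom_graft j k p q (o : 'I_j.+1) (i : 'I_q.+1) d e (x : Q 'I_j.+1 'I_k)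
    (y : Q 'I_p 'I_q.+1) : hom d x -> hom e y -> hom (d + e) (graft o i x y).
Proof. by move=> dx ey; apply: dcomp_hom; apply: dact_hom => //; bij. Qed.

Lemma hom_iter_prod n : hom 0 (ip n).
Proof.
elim: n => [|n IH]; first exact: dunit_hom.
rewrite iter_prodS; apply: dact_hom; [exact: mono_ll_out_bij|exact: iter_prod_in_bij|].
rewrite -[X in hom X]addr0; apply: hom_graft => //.
exact: (mod_dl modQ).
Qed.

Lemma hom_comb n p t : hom t%:Z (cb n p t).
Proof.
elim: t => [|t IH]; first exact: hom_iter_prod.
rewrite combS; apply: dact_hom; [exact: comb_out_bij|exact: joinr0_bij|].
rewrite -[X in hom X%:Z]addn1 PoszD; apply: hom_graft => //.
exact: (mod_dd modQ).
Qed.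

(** The number of cooperations in a comb is fixed by its number of outputs. So the span sits in one
    degree, and each graded projection keeps or kills it. *)
Lemma span_hom (A B : finType) (x : Q A B) : comb_span x -> hom (#|A|%:Z - 1) x.
Proof.
elim=> [|a y z n p t yn _ IH]; first exact: hom0.
apply: homP IH; have [cA _] := req_card yn.
move: yn => [f [g [fB gB yE]]]; apply: hom_sim yE _; apply: dact_hom => //.
have -> : #|A|%:Z - 1 = t%:Z by rewrite cA card_ord; lia.
exact: hom_comb.
Qed.

Lemma span_proj (A B : finType) d (x : Q A B) :
  comb_span x -> comb_span (gr_proj (Q A B) d x).
Proof.
move=> xs; rewrite (hom_proj _ (span_hom xs)); case: ifP => // _; exact: span_zero.
Qed.

Lemma span_unit : comb_span (dunit Q).
Proof. exact: (span_one (req_refl (cb 0 0 0))). Qed.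

Lemma span_l : comb_span l.
Proof.
apply: (@span_one _ _ _ 1 0 0); apply: req_sym.
apply: req_trans (req_act _ mono_ll_out_bij (iter_prod_in_bij 0)) _.
have lR : req (dact id (unlift (ord0 : 'I_2)) l) l by apply: req_act; bij.
apply: req_trans (req_unitl _ _) (lR); first by apply: req_act; bij.
exact: symel_req lR symel_l.
Qed.

Lemma span_del x : comb_span (del x).
Proof.
have [p xE] : exists p, x = kind p 0.
  (* p = 1 makes the single cooperation one of the first kind, p = 0 one of the second. *)
  exists (1 - x)%N; apply/val_inj; rewrite /kind.
  by case: x => [[|[|?]] ?].
apply: (@span_one _ _ _ 0 p 1); apply: req_sym.
apply: req_trans (req_act _ (comb_out_bij 0) (joinr0_bij _)) _.
rewrite -/(kind p 0) -xE.
have dR : req (dact id (unlift (ord0 : 'I_1)) (del x)) (del x) by apply: req_act; bij.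
apply: req_trans (req_unitl _ _) (dR); first by apply: req_act; bij.
exact: symel_req dR (symel_del x).
Qed.

Definition comb_family : closed_family Q :=
  @ClosedFamily K Q comb_span span_zero span_lin span_proj span_act span_comp span_unit.

End NormalForm.

(** * Expansion of the elements of the dual dioperad in combs *)

Section Expansion.
Variables (K : fieldType) (Q : dioperad K).
Variables (l : Q 'I_1 'I_2) (del : 'I_2 -> Q 'I_2 'I_1).
Hypothesis presQ : is_presented (koszul_dual (LieBi K)) l del.

Lemma presented_span (A B : finType) (x : Q A B) : comb_span l del x.
Proof.
have modQ := presQ.1.
exact: (presented_ind (V := comb_family modQ) presQ (span_l modQ) (span_del modQ)).
Qed.

Lemma presented_hom (A B : finType) (x : Q A B) : hom (#|A|%:Z - 1) x.
Proof. exact/(span_hom presQ.1)/presented_span. Qed.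

(** Combs indexed by their number of second-kind cooperations, so that the model sends them to
    ['X^i]. The value 0 is forced when m or n is 0, since a comb has at least one input and one
    output. *)
Definition nf (m n i : nat) : Q 'I_m 'I_n :=
  match m, n with
  | m'.+1, n'.+1 => comb l del n' (m' - i) m'
  | _, _ => 0
  end.

Variable F : forall A B : finType, Q A B -> model K A B.
Hypothesis FM : is_dmorphism F.
Hypothesis Fl : F l = model_l K.
Hypothesis Fd : forall x, F (del x) = model_del K x.

Lemma F_comb n p t : F (comb l del n p t) = 'X^(t - p) :> {poly K}.
Proof.
rewrite -(model_comb K n) (dmor_comb FM) Fl.
by have -> : (fun x => F (del x)) = model_del K by exact: funext.
Qed.

Lemma F_nf m n i : (i < m)%N -> (0 < n)%N -> F (nf m n i) = 'X^i :> {poly K}.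
Proof. by case: m n => [|m] [|n] // im _; rewrite F_comb subKn. Qed.

(** Both sides are linear in x, so x may be taken to be a relabelled comb up to sign. By symmetry it
    is then plus or minus some [nf], and [F] repeats that sign in the coefficient. *)
Lemma expand m n (x : Q 'I_m 'I_n) :
  x = \sum_(i < m) (F x : {poly K})`_i *: nf m n i.
Proof.
have modQ := presQ.1.
elim: (presented_span x) => [|a y z n' p t yn _ IH].
  by rewrite (dmor0 FM) big1 // => i _; rewrite coef0 scale0r.
have -> : F (a *: y + z) = a *: (F y : {poly K}) + (F z : {poly K}) :> {poly K}.
  exact: (dmorZD FM).
under eq_bigr do rewrite coefD coefZ scalerDl -scalerA.
rewrite big_split /= -IH -scaler_sumr; congr (_ *: _ + _).
have [/eqP + /eqP] := req_card yn; rewrite !card_ord => /eqP mE /eqP nE; subst m n.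
have yE : sim y (nf t.+1 n'.+1 (t - p)).
  rewrite -[nf _ _ _]dact_id; apply: symel_rel; try bij.
  - exact: symel_comb.
  (* t - (t - p) is the minimum of p and t, which determines the same comb. *)
  - rewrite /nf (@comb_ext K Q l del n' (t - (t - p)) p) // => u ut.
    by apply/idP/idP; lia.
have tp : (t - p < t.+1)%N by rewrite ltnS leq_subr.
have H (i : 'I_t.+1) : i != Ordinal tp ->
    (F (nf t.+1 n'.+1 (t - p)) : {poly K})`_i *: nf t.+1 n'.+1 i = 0.
  move=> ne; rewrite F_nf // coefXn (_ : (i == _ :> nat) = false) ?scale0r //.
  exact: negbTE.
have S : nf t.+1 n'.+1 (t - p) =
    \sum_(i < t.+1) (F (nf t.+1 n'.+1 (t - p)) : {poly K})`_i *: nf t.+1 n'.+1 i.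
  rewrite (bigD1 (Ordinal tp)) //= big1 ?addr0; last by move=> i /H.
  by rewrite F_nf // coefXn eqxx scale1r.
case: yE => [->//|->].
rewrite {1}S -sumrN; apply: eq_bigr => i _.
have -> : F (- nf t.+1 n'.+1 (t - p)) = - (F (nf t.+1 n'.+1 (t - p)) : {poly K}) :> {poly K}.
  by rewrite -scaleN1r (dmorZ FM) -[RHS]scaleN1r.
by rewrite coefN scaleNr.
Qed.

End Expansion.

(** * The isomorphism with the dual of [Q] *)

Lemma spread_bij m j (jm : (j <= m)%N) (s : 'S_m) : bijective (spread jm s).
Proof.
apply: inj_card_bij; last by rewrite card_sum !card_ord subnKC.
by move=> u v /perm_inj /cast_ord_inj /(can_inj (@unsplitK _ _)).
Qed.

Lemma dmor_two_vertex (K : fieldType) (P Q : dioperad K)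
    (f : forall A B : finType, P A B -> Q A B) m n (j : 'I_m) (k : 'I_n.+1)
    (s : 'S_m) (t : 'S_n) (x : P 'I_j.+1 'I_k) (y : P 'I_(m - j) 'I_(n - k).+1) :
  is_dmorphism f -> f _ _ (two_vertex s t x y) = two_vertex s t (f _ _ x) (f _ _ y).
Proof.
move=> fM; rewrite /two_vertex (dmor_act fM); try exact: spread_bij.
by rewrite (dmor_graft fM).
Qed.

Lemma two_vertexZl (K : fieldType) (P : dioperad K) m n (j : 'I_m) (k : 'I_n.+1)
    (s : 'S_m) (t : 'S_n) a (x : P 'I_j.+1 'I_k) (y : P 'I_(m - j) 'I_(n - k).+1) :
  two_vertex s t (a *: x) y = a *: two_vertex s t x y.
Proof.
have sB := spread_bij (ltnW (ltn_ord j)) s; have tB := spread_bij (leq_ord k) t.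
rewrite /two_vertex /graft -[a *: x]addr0 dact_linear; try bij.
rewrite dact0; try bij.
rewrite dcomp_linearl dcomp0l dact_linear // dact0 // !addr0.
by [].
Qed.

Section Phi.
Variables (K : fieldType) (Q : dioperad K).
Variables (l : Q 'I_1 'I_2) (del : 'I_2 -> Q 'I_2 'I_1).
Hypothesis presQ : is_presented (koszul_dual (LieBi K)) l del.
Variable F : forall A B : finType, Q A B -> model K A B.
Hypothesis FM : is_dmorphism F.
Hypothesis Fl : F l = model_l K.
Hypothesis Fd : forall x, F (del x) = model_del K x.

Local Notation Fp x := (F x : {poly K}).

Lemma Erank_ord m n d (i : 'I_(Erank m n d)) :
  [/\ (i < m)%N, (0 < n)%N, (3 <= m + n)%N & d = 2 - m%:Z].
Proof.
by case: i => i /=; rewrite /Erank; case: ifP => // /and4P[_ n0 mn /eqP ->].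
Qed.

Lemma ErankT m n : (0 < m)%N -> (0 < n)%N -> (3 <= m + n)%N ->
  Erank m n (2 - m%:Z) = m.
Proof. by move=> m0 n0 mn; rewrite /Erank m0 n0 mn eqxx. Qed.

Lemma nf0 m i : nf l del m 0 i = 0.
Proof. by case: m. Qed.

Lemma F_coef_eq0 m n (x : Q 'I_m 'I_n) i : (m <= i)%N -> (Fp x)`_i = 0.
Proof.
move=> mi; rewrite [x in F x](expand presQ FM Fl Fd) (dmor_sum FM).
rewrite coef_sum big1 // => u _.
rewrite (dmorZ FM) coefZ; case: n x => [|n] x.
  by rewrite nf0 (dmor0 FM) coef0 mulr0.
rewrite (F_nf FM Fl Fd) // coefXn gtn_eqF ?mulr0 //.
exact: leq_trans (ltn_ord u) mi.
Qed.

(** The basis vector with index i becomes the form taking the coefficient of ['X^i], so these forms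
    are dual to the combs [nf]. *)
Definition phi_fun m n d (v : Ebimod K m n d) : Q 'I_m 'I_n -> K^o :=
  fun x => \sum_(i < Erank m n d) (v : 'rV_(Erank m n d)) 0 i * (Fp x)`_i.

Lemma phi_funP m n d (v : Ebimod K m n d) : phi_fun v \in @coideal_pred K Q m n d.
Proof.
apply/asboolP; split.
- move=> a x y; rewrite /phi_fun -[X in _ = X + _]/(a * _) mulr_sumr -big_split /=.
  apply: eq_bigr => i _.
  have -> : Fp (a *: x + y) = a *: Fp x + Fp y by exact: (dmorZD FM).
  by rewrite coefD coefZ mulrDr mulrCA.
- move=> e x ex ne; apply: big1 => i _; have [_ _ _ dE] := Erank_ord i.
  have /(dmor_hom FM)/conc_hom[eE|->] := ex; last by rewrite coef0 mulr0.
  by case/eqP: ne; rewrite eE dE card_ord; lia.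
- by move=> mn x; apply: big1 => i _; have [_ _] := Erank_ord i; lia.
Qed.

Definition phi m n d (v : Ebimod K m n d) : coideal_bimod Q m n d :=
  Coideal (phi_funP v).

Definition psi m n d (f : coideal_bimod Q m n d) : Ebimod K m n d :=
  \row_(i < Erank m n d) (f : coideal Q m n d) (nf l del m n i).

Lemma phiK m n d : cancel (@phi m n d) (@psi m n d).
Proof.
move=> v; apply/rowP => i; rewrite mxE /= /phi_fun.
have [im n0 _ _] := Erank_ord i.
rewrite (F_nf FM Fl Fd) // (bigD1 i) //= coefXn eqxx mulr1 big1 ?addr0 // => u ui.
by rewrite coefXn (_ : (u == i :> nat) = false) ?mulr0 //; apply: negbTE.
Qed.

Lemma coidealP m n d (f : coideal Q m n d) : [/\ linear f,
    forall e x, hom e x -> e != 1 - d -> f x = 0 &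
    (m + n < 3)%N -> forall x, f x = 0].
Proof. by case: f => f /= /asboolP. Qed.

Lemma psiK m n d : cancel (@psi m n d) (@phi m n d).
Proof.
move=> f; apply: coideal_ext => x /=; rewrite /phi_fun.
have [fl fh f0] := coidealP (f : coideal Q m n d).
under eq_bigr do rewrite mxE mulrC.
have z0 : (f : coideal Q m n d) 0 = 0.
  by have := fl (-1) 0 0; rewrite scaler0 addr0 => ->; rewrite scaleN1r addNr.
have fsum (r : seq 'I_m) (c : 'I_m -> K) (G : 'I_m -> Q 'I_m 'I_n) :
    (f : coideal Q m n d) (\sum_(i <- r) c i *: G i)
    = \sum_(i <- r) c i * (f : coideal Q m n d) (G i).
  by elim/big_rec2: _ => // i u v _ <-; rewrite fl.
have E := expand presQ FM Fl Fd x.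
rewrite [in RHS]E fsum.
(* Outside this range E is zero and the form must vanish: by [expand] if m or n is 0, by the coideal
   condition if m + n < 3, and otherwise because all of Q(m,n) has degree m - 1, which is not 1 -
   d. *)
have [c|c] := boolP [&& (0 < m)%N, (0 < n)%N, (3 <= m + n)%N & d == 2 - m%:Z].
  by rewrite /Erank c.
rewrite /Erank (negbTE c) big_ord0; apply/esym.
rewrite -fsum -E; move: c; rewrite !negb_and -!leqNgt !leqn0.
case/or4P => [/eqP m0|/eqP n0|mn|dN].
- by rewrite E fsum big1 // => -[i im]; exfalso; rewrite m0 in im.
- by rewrite E fsum big1 // => i _; rewrite (_ : nf l del m n i = 0) ?z0 ?mulr0 // n0 nf0.
- by apply: f0; rewrite ltnNge -ltnNge.
- apply: (fh _ _ (presented_hom presQ x)); apply: contraNneq dN => e.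
  by apply/eqP; move: e; rewrite card_ord; lia.
Qed.

Lemma phi_iso : is_bimod_iso phi.
Proof.
split.
- move=> m n d a u v; apply: coideal_ext => x /=.
  rewrite /phi_fun -[RHS]/(a * _ + _) mulr_sumr -big_split /=.
  by apply: eq_bigr => i _; rewrite !mxE mulrDl mulrA.
- by move=> m n d; exists (@psi m n d); [exact: phiK | exact: psiK].
- move=> m n d s t v; apply: coideal_ext => x /=; rewrite /phi_fun.
  apply: eq_bigr => i _; rewrite /Eact !mxE.
  rewrite (dmor_act FM); try exact: perm_bij.
  by rewrite model_actE coefZ sgn_perm odd_permV mulrCA mulrA.
Qed.

Lemma phi_basis m n i (x : Q 'I_m 'I_n) : (0 < n)%N -> (3 <= m + n)%N -> (i < m)%N ->
  (phi (Ebasis K m n i) : coideal Q m n _) x = (Fp x)`_i.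
Proof.
move=> n0 mn im; have m0 : (0 < m)%N by apply: leq_ltn_trans im.
rewrite /= /phi_fun; have im' : (i < Erank m n (2 - m%:Z))%N by rewrite ErankT.
rewrite (bigD1 (Ordinal im')) //= mxE eqxx mul1r big1 ?addr0 // => u ui.
by rewrite mxE (_ : (u == i :> nat) = false) ?mul0r //; apply: negbTE.
Qed.

Lemma phi_dual m n i i' : (1 <= m + n)%N -> (i <= m)%N -> (i' <= m)%N ->
  (phi (Ebasis K m.+1 n.+1 i) : coideal Q _ _ _) (comb l del n (m - i') m)
    = (i == i')%:R :> K.
Proof.
move=> mn im i'm; rewrite phi_basis //; last by rewrite addSn addnS !ltnS.
by rewrite (F_comb FM Fl Fd) subKn // coefXn.
Qed.

Lemma phi_free (P : dioperad K)
    (iota : forall m n d, coideal_bimod Q m n d -> P 'I_m 'I_n) :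
  is_free iota -> is_free (fun m n d (v : Ebimod K m n d) => iota m n d (phi v)).
Proof.
move=> [[il ih ia] U]; have [pl _ pa] := phi_iso; split.
  split=> [m n d a u v|m n d x|m n d s t x]; first by rewrite pl il.
    exact: ih.
  by rewrite pa ia.
move=> D g [gl gh ga].
have [] := U D (fun m n d f => g m n d (psi f)).
  split=> [m n d a u v|m n d x|m n d s t x].
  - rewrite -gl (_ : psi _ = a *: psi u + psi v) //.
    by apply: (can_inj (@phiK m n d)); rewrite pl !psiK.
  - exact: gh.
  - rewrite -ga (_ : psi _ = sact s t (psi x)) //.
    by apply: (can_inj (@phiK m n d)); rewrite pa !psiK.
move=> f [fM fi] fU; exists f => [|f' f'M f'i A B x].
  by split=> // m n d v; rewrite fi phiK.
by apply: fU => // m n d u; rewrite -{1}[u]psiK f'i.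
Qed.

(** * Cocomposition of the basis and the differential *)

Lemma coefM_pairs (a b : nat) (p q : {poly K}) i :
  (forall u, (a <= u)%N -> p`_u = 0) -> (forall v, (b <= v)%N -> q`_v = 0) ->
  (p * q)`_i = \sum_(w : 'I_a * 'I_b | (w.1 + w.2 == i)%N) p`_(w.1) * q`_(w.2).
Proof.
move=> pa qb.
have E (c : nat) (r : {poly K}) : (forall u, (c <= u)%N -> r`_u = 0) ->
    r = \sum_(u < c) r`_u *: 'X^u.
  move=> rc; rewrite -poly_def; apply/polyP => u; rewrite coef_poly.
  by case: ltnP => // /rc.
rewrite {1}(E _ _ pa) {1}(E _ _ qb) big_distrlr /= pair_big /= coef_sum [RHS]big_mkcond /=.
apply: eq_bigr => -[u v] _ /=.
by rewrite -scalerAl -scalerAr scalerA -exprD coefZ coefXn eq_sym; case: eqP;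
  rewrite ?mulr1 ?mulr0.
Qed.

Local Notation c m n i := (phi (Ebasis K m n i) : coideal Q m n (2 - m%:Z)).

(** The sign of the two-vertex graph in the model is placed on the left factor, whence linearity of
    [iota] extracts it later. *)
Definition cocomp_basis m n (i : nat) : cotensors Q m n := fun j k s t =>
  [seq (existT (fun d => coideal Q j.+1 k d) (2 - j.+1%:Z)
          ((-1) ^+ (odd_perm s + (j + j * (m - j))) *: c j.+1 k w.1),
        existT (fun d => coideal Q (m - j) (n - k).+1 d) (2 - (m - j)%:Z)
          (c (m - j)%N (n - k).+1 w.2))
  | w : 'I_j.+1 * 'I_(m - j) <- enum [pred w : 'I_j.+1 * 'I_(m - j) | (w.1 + w.2 == i)%N]].

Lemma cocomp_basisP m n i : (0 < n)%N -> (3 <= m + n)%N -> (i < m)%N ->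
  is_cocomposition (c m n i) (@cocomp_basis m n i).
Proof.
move=> n0 mn im j k s t /and4P[k0 /andP[jk1 jk2] _ _] x y.
rewrite phi_basis // (dmor_two_vertex _ _ _ _ FM) model_two_vertexE coefZ.
rewrite (@coefM_pairs j.+1 (m - j)); try by move=> u; exact: F_coef_eq0.
rewrite big_map big_enum mulr_sumr; apply: eq_bigr => -[u v] _ /=.
have jm := ltn_ord j; have kn := leq_ord k.
rewrite -[X in _ = X * _]/(_ * c j.+1 k u x).
(* The two bounds on j + k in [is_shape] say that each vertex has at least three legs, as
   [phi_basis] requires. *)
rewrite -[X in _ = _ * X]/(c (m - j)%N (n - k).+1 v y) !phi_basis ?mulrA //; lia.
Qed.

Lemma phi_diff (Om : dgdioperad K)
    (iota : forall m n d, coideal_bimod Q m n d -> Om 'I_m 'I_n) m n i :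
  is_cobar iota -> (1 <= m)%N -> (1 <= n)%N -> (3 <= m + n)%N -> (i < m)%N ->
  diff (iota _ _ _ (c m n i)) =
    \sum_(j < m) \sum_(k < n.+1 | (1 <= k)%N && (2 <= j + k <= m + n - 2)%N)
    \sum_(i1 < j.+1) \sum_(i2 < m - j | (i1 + i2 == i)%N)
    \sum_(t : 'S_n | is_shuffle k t) \sum_(s : 'S_m | is_shuffle j s)
      (-1) ^+ (odd_perm s + j * (m - j)) *:
        two_vertex s t (iota _ _ _ (c j.+1 k i1)) (iota _ _ _ (c (m - j)%N (n - k).+1 i2)).
Proof.
move=> [[[il ih ia] _] Od] m0 n0 mn im.
rewrite (Od _ _ _ _ _ (cocomp_basisP n0 mn im)).
apply: eq_bigr => j _; rewrite [RHS]big_mkcond; apply: eq_bigr => k _.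
case: ifP => C; last first.
  apply: big1 => s _; apply: big1 => t /and4P[k0 jk _ _].
  by rewrite k0 jk in C.
(* The sums over i1 and i2 are merged into one over pairs and moved inside the shuffles, matching
   the list of [cocomp_basis]. *)
rewrite [RHS]pair_big_dep /=.
under [RHS]eq_bigr do rewrite exchange_big.
rewrite [RHS]exchange_big [RHS]big_mkcond /=; apply: eq_bigr => s _.
case: ifP => sh; last first.
  by rewrite big_pred0 // => t; rewrite /is_shape sh !andbF.
rewrite [RHS]exchange_big /=; apply: eq_big => [t|t _].
  by rewrite /is_shape sh /=; case/andP: C => -> ->.
rewrite big_map big_enum; apply: eq_bigr => w _ /=.
have iZ a d (v : coideal Q j.+1 k d) : iota _ _ _ (a *: v) = a *: iota _ _ _ v.
  have i0 : iota j.+1 k d 0 = 0.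
    by have := il j.+1 k d (-1) 0 0; rewrite scaler0 addr0 => ->; rewrite scaleN1r addNr.
  by have := il j.+1 k d a v 0; rewrite !addr0 i0 addr0.
rewrite iZ two_vertexZl scalerA; congr (_ *: _).
(* The unsuspended left factor has degree -j; its cobar sign cancels the term j in the sign of the
   graph. *)
have -> : ksign K (2 - j.+1%:Z - 1) = (-1) ^+ j.
  rewrite /ksign (_ : 2 - j.+1%:Z - 1 = - j%:Z) ?abszN //; lia.
rewrite -exprD; apply: signr_eq; rewrite !oddD.
by case: (odd j); case: (odd (odd_perm s)); case: (odd (j * _)).
Qed.

End Phi.

Theorem theorem5p4p1 (K : fieldType) (char0 : [pchar K] =i pred0)
  (* the dioperad P = F(M)/(R) *)
  (P : dioperad K) (l : P 'I_1 'I_2) (del : 'I_2 -> P 'I_2 'I_1)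
  (presP : is_presented (LieBi K) l del)
  (* the dioperad Q whose linear dual is the Koszul dual codioperad of P *)
  (Q : dioperad K) (lQ : Q 'I_1 'I_2) (delQ : 'I_2 -> Q 'I_2 'I_1)
  (presQ : is_presented (koszul_dual (LieBi K)) lQ delQ)
  (* the Koszul resolution of P *)
  (Pinf : dgdioperad K)
  (iota : forall m n d, coideal_bimod Q m n d -> Pinf 'I_m 'I_n)
  (cobarP : is_cobar iota) :
  exists phi : forall m n d, Ebimod K m n d -> coideal_bimod Q m n d,
  let c m n i := iota m n (2 - m%:Z) (phi m n (2 - m%:Z) (Ebasis K m n i)) in
  [/\ is_bimod_iso phi,
      forall m n i i', (1 <= m + n)%N -> (i <= m)%N -> (i' <= m)%N ->
        (phi m.+1 n.+1 (2 - (m.+1)%:Z) (Ebasis K m.+1 n.+1 i) : coideal _ _ _ _)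
          (comb lQ delQ n (m - i') m) = (i == i')%:R :> K,
      is_free (fun m n d (v : Ebimod K m n d) => iota m n d (phi m n d v)) &
      forall m n i, (1 <= m)%N -> (1 <= n)%N -> (3 <= m + n)%N -> (i < m)%N ->
        diff (c m n i) =
          \sum_(j < m) \sum_(k < n.+1 | (1 <= k)%N && (2 <= j + k <= m + n - 2)%N)
          \sum_(i1 < j.+1) \sum_(i2 < m - j | (i1 + i2 == i)%N)
          \sum_(t : 'S_n | is_shuffle k t) \sum_(s : 'S_m | is_shuffle j s)
            (-1) ^+ (odd_perm s + j * (m - j)) *:
              two_vertex s t (c j.+1 k i1) (c (m - j)%N (n - k).+1 i2)].
Proof.
(* The polynomial model satisfies the dual relations, so the presentation of [Q] yields the morphism
   whose coefficients define [phi]. *)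
have [F [FM [Fl Fd]] _] := presQ.2 _ _ _ (model_is_model K).
exists (phi FM) => c; split.
- exact: (phi_iso presQ FM Fl Fd).
- exact: (phi_dual FM Fl Fd).
- exact: (phi_free presQ FM Fl Fd cobarP.1).
- by move=> m n i m0 n0 mn im; apply: (phi_diff presQ FM Fl Fd cobarP).
Qed.
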